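(* For every integer $n\ge1$, the map $$\Psi_n:\mathbf{B}(n\Lambda_0)\otimes T_{-n\Lambda_0}\longrightarrow\mathcal{M},\qquad \Psi_n(\mathbf w\otimes t_{-n\Lambda_0})=\kappa^{-1}(\mathbf w^\vee_{<0},\mathbf w_{>0}),$$ is an embedding of $\mathfrak{gl}_\infty$-crystals.
   Context: **Lie algebra and weights.** $\mathbb{Z}^\times=\mathbb{Z}\setminus\{0\}$. $\mathfrak{gl}_\infty$ is the Lie algebra of complex $\mathbb{Z}^\times\times\mathbb{Z}^\times$ matrices with finitely many nonzero entries; $E_{ij}$ are the elementary matrices, $\mathfrak{h}=\bigoplus_{i\in\mathbb{Z}^\times}\mathbb{C}E_{ii}$, and $\epsilon_i\in\mathfrak{h}^*$ is given by $\langle\epsilon_i,E_{jj}\rangle=\delta_{ij}$. Simple coroots: $h_0=E_{-1,-1}-E_{11}$, $h_i=E_{ii}-E_{i+1,i+1}$, $h_{-i}=E_{-i-1,-i-1}-E_{-i,-i}$ ($i\ge1$). Simple roots: $\alpha_0=\epsilon_{-1}-\epsilon_1$, $\alpha_i=\epsilon_i-\epsilon_{i+1}$, $\alpha_{-i}=\epsilon_{-i-1}-\epsilon_{-i}$ ($i\ge1$). $\Lambda_0\in\mathfrak{h}^*$ is given by $\langle\Lambda_0,E_{-i,-i}\rangle=-\langle\Lambda_0,E_{ii}\rangle=\frac12$ ($i\geq1$). $P=\bigoplus_{i\in\mathbb{Z}^\times}\mathbb{Z}\epsilon_i\oplus\mathbb{Z}\Lambda_0$. **Crystals.** A $\mathfrak{gl}_\infty$-crystal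 is a set $B$ with maps $\mathrm{wt}:B\to P$, $\varepsilon_i,\varphi_i:B\to\mathbb{Z}\cup\{-\infty\}$, $\widetilde e_i,\widetilde f_i:B\to B\cup\{\mathbf 0\}$ ($i\in\mathbb{Z}$; $\mathbf 0\notin B$ a formal symbol, with $\widetilde e_i\mathbf 0=\widetilde f_i\mathbf 0=\mathbf 0$) such that for $b,b'\in B$: (1) $\varphi_i(b)=\langle\mathrm{wt}(b),h_i\rangle+\varepsilon_i(b)$; (2) if $\widetilde e_ib\in B$, then $\varepsilon_i(\widetilde e_ib)=\varepsilon_i(b)-1$, $\varphi_i(\widetilde e_ib)=\varphi_i(b)+1$, $\mathrm{wt}(\widetilde e_ib)=\mathrm{wt}(b)+\alpha_i$; (3) if $\widetilde f_ib\in B$, then $\varepsilon_i(\widetilde f_ib)=\varepsilon_i(b)+1$, $\varphi_i(\widetilde f_ib)=\varphi_i(b)-1$, $\mathrm{wt}(\widetilde f_ib)=\mathrm{wt}(b)-\alpha_i$; (4) $\widetilde f_ib=b'$ iff $b=\widetilde e_ib'$; (5) if $\varphi_i(b)=-\infty$ then $\widetilde e_ib=\widetilde f_ib=\mathbf 0$. $\mathfrak{gl}_{>0}$-crystals (resp. $\mathfrak{gl}_{<0}$-crystals) are defined likewise using only indices $i>0$ (resp. $i<0$). A morphism $\psi:B_1\to B_2$ is a map $B_1\cup\{\mathbf 0\}\to B_2\cup\{\mathbf 0\}$ with $\psi(\mathbf 0)=\mathbf 0$, preserving $\mathrm{wt},\varepsilon_i,\varphi_i$ on each $b$ with $\psi(b)\ne\mathbf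 0$, and with $\psi(\widetilde x_ib)=\widetilde x_i\psi(b)$ ($x=e,f$) whenever $b\in B_1$, $\psi(b)\neq\mathbf 0$ and $\psi(\widetilde x_ib)\ne\mathbf 0$. An embedding is an injective morphism. Tensor product: $B_1\otimes B_2=\{b_1\otimes b_2\}$ with $\mathrm{wt}(b_1\otimes b_2)=\mathrm{wt}(b_1)+\mathrm{wt}(b_2)$, $\varepsilon_i(b_1\otimes b_2)=\max(\varepsilon_i(b_1),\varepsilon_i(b_2)-\langle\mathrm{wt}(b_1),h_i\rangle)$, $\varphi_i(b_1\otimes b_2)=\max(\varphi_i(b_1)+\langle\mathrm{wt}(b_2),h_i\rangle,\varphi_i(b_2))$; $\widetilde e_i(b_1\otimes b_2)$ is $\widetilde e_ib_1\otimes b_2$ if $\varphi_i(b_1)\ge\varepsilon_i(b_2)$ and $b_1\otimes\widetilde e_ib_2$ otherwise; $\widetilde f_i(b_1\otimes b_2)$ is $\widetilde f_ib_1\otimes b_2$ if $\varphi_i(b_1)>\varepsilon_i(b_2)$ and $b_1\otimes\widetilde f_ib_2$ otherwise (where $\mathbf 0\otimes b_2=b_1\otimes\mathbf 0=\mathbf 0$). For $\lambda\in P$, $T_\lambda=\{t_\lambda\}$ is the crystal with $\mathrm{wt}(t_\lambda)=\lambda$, $\widetilde e_it_\lambda=\widetilde f_it_\lambda=\mathbf 0$, $\varepsilon_i(t_\lambda)=\varphi_i(t_\lambda)=-\infty$. **Letters and words.** $\mathbf{B}_{>0}=\{1<2<3<\cdots\}$ is the $\mathfrak{gl}_{>0}$-crystal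 $1\stackrel{1}{\to}2\stackrel{2}{\to}3\to\cdots$ with $\mathrm{wt}(k)=\epsilon_k$; $\mathbf{B}^\vee_{<0}=\{-1^\vee<-2^\vee<-3^\vee<\cdots\}$ is the $\mathfrak{gl}_{<0}$-crystal $-1^\vee\stackrel{-1}{\to}-2^\vee\stackrel{-2}{\to}-3^\vee\to\cdots$ with $\mathrm{wt}(-k^\vee)=-\epsilon_{-k}$. Here $b\stackrel{i}{\to}b'$ means $b'=\widetilde f_ib$, and $\varepsilon_i(b)$ (resp. $\varphi_i(b)$) is the number of $i$-arrows into (resp. out of) $b$. A word $w_1\cdots w_r$ is identified with $w_1\otimes\cdots\otimes w_r$ (the empty word has weight $0$, $\varepsilon_i=\varphi_i=0$, and is killed by all operators). **The crystal $\mathcal{M}$.** $\mathcal{M}$ is the set of matrices $A=(a_{-i^\vee,j})_{i,j\ge1}$ with entries in $\mathbb{Z}_{\ge0}$ and finitely many nonzero entries. To $A$ associate two-row words $(\mathbf i,\mathbf j)$ and $(\mathbf k,\mathbf l)$, each containing the pair $(-i^\vee,j)$ exactly $a_{-i^\vee,j}$ times: in $(\mathbf i,\mathbf j)$ the pairs $(i_m,j_m)$ are sorted so that $j_1\le j_2\le\cdots$ and $i_m\ge i_{m+1}$ whenever $j_m=j_{m+1}$; in $(\mathbf k,\mathbf l)$ the pairs $(k_m,l_m)$ are sorted so that $k_1\le k_2\le\cdots$ and $l_m\ge l_{m+1}$ whenever $k_m=k_{m+1}$. For $i<0$, $\widetilde e_i,\widetilde f_i$ act on $A$ by acting on $\mathbf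 i$ and fixing $\mathbf j$, with $\varepsilon_i(A)=\varepsilon_i(\mathbf i)$, $\varphi_i(A)=\varphi_i(\mathbf i)$; for $i>0$ they act on $\mathbf l$, fixing $\mathbf k$, with $\varepsilon_i(A)=\varepsilon_i(\mathbf l)$, $\varphi_i(A)=\varphi_i(\mathbf l)$. For $i=0$: $\widetilde f_0A=A+E_{-1^\vee,1}$; $\widetilde e_0A=A-E_{-1^\vee,1}$ if $a_{-1^\vee,1}\ne0$ and $\mathbf 0$ otherwise; $\varepsilon_0(A)=a_{-1^\vee,1}$; $\varphi_0(A)=\langle\mathrm{wt}(A),h_0\rangle+\varepsilon_0(A)$. Finally $\mathrm{wt}(A)=\sum_{i,j\ge1}a_{-i^\vee,j}(-\epsilon_{-i}+\epsilon_j)$. **Tableaux and $\kappa$.** $\nu^\pi$ is the $180^\circ$-rotation of the Young diagram of a partition $\nu$ (rows right-justified, $i$-th row from the bottom of length $\nu_i$, columns bottom-aligned), and $SST_{\mathcal A}(\nu^\pi)$ is the set of semistandard tableaux of shape $\nu^\pi$ with entries in $\mathcal A$ (rows weakly increasing left to right, columns strictly increasing top to bottom). For such a tableau $T$ and a letter $a$, $T\leftarrow a$ is obtained as follows: let $a'$ be the largest entry $\le a$ in the rightmost column and replace $a'$ by $a$; if there is no such $a'$, put $a$ on top of that column and stop; otherwise repeat with $a'$ in the next column to the left. $\mathbf P(w_1\cdots w_r)=(\cdots((w_1\leftarrow w_2)\leftarrow w_3)\cdots)\leftarrow w_r$. For $A\in\mathcal{M}$ put $\mathbf P(A)=\mathbf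 P(\mathbf i_{\rm rev})$, $\mathbf Q(A)=\mathbf P(\mathbf l_{\rm rev})$ (rev = reversed word). The map $\kappa(A)=(\mathbf P(A),\mathbf Q(A))$ is a bijection $\mathcal{M}\to\mathcal{T}=\bigsqcup_\nu SST_{\mathbf{B}^\vee_{<0}}(\nu^\pi)\times SST_{\mathbf{B}_{>0}}(\nu^\pi)$. **The crystal $\mathbf{B}(n\Lambda_0)$.** Let $\mathbf{B}=\mathbb{Z}^\times$ with the usual order. A semi-infinite word is $w=\cdots w_{-3}w_{-2}w_{-1}$ with letters in $\mathbf{B}$, $w_{i-1}<w_i$ for all $i<0$, and $w_i=i+c$ for $i\ll0$ for some $c\in\mathbb{Z}$; $\mathcal{F}$ is the set of these. $\mathrm{wt}(w)=\Lambda_0+\sum_km_k\epsilon_k$ with $m_k=|\{i:w_i=k\}|-1$ for $k<0$ and $m_k=|\{i:w_i=k\}|$ for $k>0$. Let $(p_i,q_i)$ be $(i,i+1)$ for $i>0$, $(-1,1)$ for $i=0$, $(i-1,i)$ for $i<0$. $\widetilde f_iw$ replaces the letter $p_i$ by $q_i$ if $p_i$ occurs in $w$ and $q_i$ does not (then $\varphi_i(w)=1$), and is $\mathbf 0$ otherwise ($\varphi_i(w)=0$); $\widetilde e_iw$ replaces $q_i$ by $p_i$ if $q_i$ occurs and $p_i$ does not ($\varepsilon_i(w)=1$), and is $\mathbf 0$ otherwise ($\varepsilon_i(w)=0$). $\mathbf{B}(\Lambda_c)\subset\mathcal{F}$ consists of the words with constant $c$. $\mathbf{B}(n\Lambda_0)$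 is the set of $n$-tuples $\mathbf w=(w^{(1)},\dots,w^{(n)})$ with $w^{(i)}\in\mathbf{B}(\Lambda_0)$ and $w^{(i+1)}_k\le w^{(i)}_k$ for $1\le i<n$, $k<0$; it is a crystal as a subset of $\mathbf{B}(\Lambda_0)^{\otimes n}$ via $\mathbf w=w^{(1)}\otimes\cdots\otimes w^{(n)}$. ($\mathbf w$ is viewed as a tableau whose $k$-th column from the right is $w^{(k)}$.) **$\mathbf w_{>0}$ and $\mathbf w^\vee_{<0}$.** For $\mathbf w\in\mathbf{B}(n\Lambda_0)$, $\mathbf w_{>0}\in SST_{\mathbf{B}_{>0}}(\mu^\pi)$ is the subtableau of positive entries, for some partition $\mu$ with $\mu_1\le n$; its $k$-th column from the right consists of the positive letters of $w^{(k)}$ and has length $\mu'_k$ ($\mu'$ the conjugate). Let $-i_{k,1}>\cdots>-i_{k,\mu'_k}$ be the negative integers not occurring in $w^{(k)}$. Then $\mathbf w^\vee_{<0}\in SST_{\mathbf{B}^\vee_{<0}}(\mu^\pi)$ is the tableau whose $k$-th column from the right has entries $-i^\vee_{k,1}<\cdots<-i^\vee_{k,\mu'_k}$ from top to bottom. *)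

(* Defs.v *)
(* MathComp with finmap multisets, the free abelian groups of multinomials,
   and the classical layer of MathComp-Analysis. *)
From mathcomp Require Import all_boot all_order all_algebra.
From mathcomp Require Import finmap multiset.
From mathcomp Require Import freeg.
From mathcomp Require Import boolp classical_sets cardinality fsbigop.

Set Implicit Arguments.
Unset Strict Implicit.
Unset Printing Implicit Defensive.

Import Order.TTheory GRing.Theory Num.Theory.
Local Open Scope ring_scope.

(** * Weights *)

(* Z^x, the nonzero integers. *)
Notation zstar := {k : int | k != 0}.

Definition zpos (m : nat) : zstar := exist _ (m.+1%:Z) isT.
Definition zneg (m : nat) : zstar := exist _ (- m.+1%:Z) isT.

(* The weight lattice: (x, c) stands for x + c Lambda_0, where x is a finite
   integer combination of the epsilon_k. *)
Notation weight := ({freeg zstar / int} * int)%type.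

Definition epsilon (k : zstar) : weight := (<< k >>, 0).
Definition Lambda0 : weight := (0, 1).

(* (lp i, lq i) is (i, i+1) for i > 0, (-1, 1) for i = 0 and (i-1, i) for
   i < 0.  In all cases alpha_i = epsilon_(lp i) - epsilon_(lq i) and
   h_i = E_(lp i, lp i) - E_(lq i, lq i). *)
Lemma lp_neq0 (i : int) : (if 0 < i then i else i - 1) != 0.
Proof. by case: i => [[|m]|m]. Qed.
Lemma lq_neq0 (i : int) : (if 0 <= i then i + 1 else i) != 0.
Proof.
case: ifP => [i_ge0|]; last by case: i.
exact: lt0r_neq0 (ltr_wpDl i_ge0 ltr01).
Qed.

Definition lp (i : int) : zstar := exist (fun k => k != 0) _ (lp_neq0 i).
Definition lq (i : int) : zstar := exist (fun k => k != 0) _ (lq_neq0 i).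

Definition alpha (i : int) : weight := epsilon (lp i) - epsilon (lq i).

(* <lam, E_kk>; it is only half-integral, because of Lambda_0. *)
Definition pairE (lam : weight) (k : zstar) : rat :=
  (coeff k lam.1)%:~R + lam.2%:~R * (if val k < 0 then 1 / 2 else - (1 / 2)).

(* <lam, h_i>, an integer; see [pairing_correct]. *)
Definition pairing (lam : weight) (i : int) : int :=
  coeff (lp i) lam.1 - coeff (lq i) lam.1 + (if i == 0 then lam.2 else 0).

Lemma pairing_correct (lam : weight) (i : int) :
  (pairing lam i)%:~R = pairE lam (lp i) - pairE lam (lq i).
Proof.
rewrite /pairing /pairE !rmorphD rmorphN /= opprD addrACA; congr (_ + _).
by case: i => [[|m]|m] /=; rewrite ?subrr //= mulrN opprK -mulrDr
  -mulrDl -[1 + 1]/(2%:R) divff ?mulr1.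
Qed.

(** * Crystals *)

Definition b2z (b : bool) : int := (nat_of_bool b)%:Z.

(* Z with -oo adjoined; None is -oo. *)
Definition zbar := option int.
Definition zadd (x : zbar) (c : int) : zbar := omap (fun a => a + c) x.
Definition zle (x y : zbar) : bool :=
  match x, y with
  | None, _ => true
  | Some _, None => false
  | Some a, Some b => a <= b
  end.
Definition zmax (x y : zbar) : zbar := if zle x y then y else x.

(* A set with the maps of a crystal.  The target B + {0} of the operators is
   [option B], with None for the formal symbol 0. *)
Record precrystal := Precrystal {
  carrier :> Type;
  wt : carrier -> weight;
  eps : int -> carrier -> zbar;
  phi : int -> carrier -> zbar;
  et : int -> carrier -> option carrier;
  ft : int -> carrier -> option carrier }.

Record is_crystal (B : precrystal) : Prop := IsCrystal {
  crystal_phi : forall i (b : B), phi i b = zadd (eps i b) (pairing (wt b) i);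
  crystal_et : forall i (b b' : B), et i b = Some b' ->
    [/\ eps i b' = zadd (eps i b) (- 1), phi i b' = zadd (phi i b) 1
      & wt b' = wt b + alpha i];
  crystal_ft : forall i (b b' : B), ft i b = Some b' ->
    [/\ eps i b' = zadd (eps i b) 1, phi i b' = zadd (phi i b) (- 1)
      & wt b' = wt b - alpha i];
  crystal_etft : forall i (b b' : B), ft i b = Some b' <-> et i b' = Some b;
  crystal_ninfty : forall i (b : B), phi i b = None ->
    et i b = None /\ ft i b = None }.

(* The operators are extended by 0 |-> 0, that is, by [obind]. *)
Record crystal_morphism (B1 B2 : precrystal) (psi : option B1 -> option B2)
    : Prop := CrystalMorphism {
  morphism_zero : psi None = None;
  morphism_wt : forall b b', psi (Some b) = Some b' -> wt b' = wt b;
  morphism_eps : forall i b b', psi (Some b) = Some b' -> eps i b' = eps i b;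
  morphism_phi : forall i b b', psi (Some b) = Some b' -> phi i b' = phi i b;
  morphism_et : forall i b, psi (Some b) <> None -> psi (et i b) <> None ->
    psi (et i b) = obind (@et B2 i) (psi (Some b));
  morphism_ft : forall i b, psi (Some b) <> None -> psi (ft i b) <> None ->
    psi (ft i b) = obind (@ft B2 i) (psi (Some b)) }.

Definition crystal_embedding (B1 B2 : precrystal)
    (psi : option B1 -> option B2) : Prop :=
  [/\ is_crystal B1, is_crystal B2, crystal_morphism psi & injective psi].

Definition tensor (B1 B2 : precrystal) : precrystal := {|
  carrier := (B1 * B2)%type;
  wt b := wt b.1 + wt b.2;
  eps i b := zmax (eps i b.1) (zadd (eps i b.2) (- pairing (wt b.1) i));
  phi i b := zmax (zadd (phi i b.1) (pairing (wt b.2) i)) (phi i b.2);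
  et i b := if zle (eps i b.2) (phi i b.1)
            then omap (fun b1 => (b1, b.2)) (et i b.1)
            else omap (fun b2 => (b.1, b2)) (et i b.2);
  ft i b := if ~~ zle (phi i b.1) (eps i b.2)
            then omap (fun b1 => (b1, b.2)) (ft i b.1)
            else omap (fun b2 => (b.1, b2)) (ft i b.2) |}.

Definition Tcrystal (lam : weight) : precrystal := {|
  carrier := unit;
  wt _ := lam;
  eps _ _ := None;
  phi _ _ := None;
  et _ _ := None;
  ft _ _ := None |}.

(* Words w_1 ... w_r = w_1 (x) ... (x) w_r over the letters B, bracketed to
   the right and ending with the empty word; the latter is neutral because
   phi_i >= 0 for all the letters used below. *)
Definition word_wt (B : precrystal) (s : seq B) : weight := \sum_(b <- s) wt b.

Fixpoint word_eps (B : precrystal) (i : int) (s : seq B) : zbar :=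
  if s is b :: s'
  then zmax (eps i b) (zadd (word_eps i s') (- pairing (wt b) i))
  else Some 0.

Fixpoint word_phi (B : precrystal) (i : int) (s : seq B) : zbar :=
  if s is b :: s'
  then zmax (zadd (phi i b) (pairing (word_wt s') i)) (word_phi i s')
  else Some 0.

Fixpoint word_et (B : precrystal) (i : int) (s : seq B) : option (seq B) :=
  if s is b :: s' then
    if zle (word_eps i s') (phi i b) then omap (cons^~ s') (et i b)
    else omap (cons b) (word_et i s')
  else None.

Fixpoint word_ft (B : precrystal) (i : int) (s : seq B) : option (seq B) :=
  if s is b :: s' then
    if ~~ zle (phi i b) (word_eps i s') then omap (cons^~ s') (ft i b)
    else omap (cons b) (word_ft i s')
  else None.

Definition words (B : precrystal) : precrystal := {|
  carrier := seq B;
  wt := @word_wt B;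
  eps := @word_eps B;
  phi := @word_phi B;
  et := @word_et B;
  ft := @word_ft B |}.

(* A subset of a crystal, with the arrows joining two of its elements. *)
Definition subcrystal (B : precrystal) (S : pred B) : precrystal := {|
  carrier := {b : B | S b};
  wt b := wt (val b);
  eps i b := eps i (val b);
  phi i b := phi i (val b);
  et i b := obind insub (et i (val b));
  ft i b := obind insub (ft i (val b)) |}.

(** * Letters *)

(* Both alphabets are represented by nat with its usual order: m stands for
   the letter m+1 of B_{>0} and for the letter -(m+1)^v of B^v_{<0}.  The
   former only has i-arrows for i > 0, the latter only for i < 0; the other
   indices are never used with these letters. *)
Definition Bpos : precrystal := {|
  carrier := nat;
  wt m := epsilon (zpos m);
  eps i m := Some (b2z ((0 < i) && (m.+1%:Z == i + 1)));
  phi i m := Some (b2z ((0 < i) && (m.+1%:Z == i)));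
  et i m := if (0 < i) && (m.+1%:Z == i + 1) then Some m.-1 else None;
  ft i m := if (0 < i) && (m.+1%:Z == i) then Some m.+1 else None |}.

Definition Bneg_dual : precrystal := {|
  carrier := nat;
  wt m := - epsilon (zneg m);
  eps i m := Some (b2z ((i < 0) && (- m.+1%:Z == i - 1)));
  phi i m := Some (b2z ((i < 0) && (- m.+1%:Z == i)));
  et i m := if (i < 0) && (- m.+1%:Z == i - 1) then Some m.-1 else None;
  ft i m := if (i < 0) && (- m.+1%:Z == i) then Some m.+1 else None |}.

(** * The crystal M *)

(* A matrix with finitely many nonzero entries in nat is a multiset of
   positions: A (a, b) is its entry in row -(a+1)^v and column b+1, and the
   sequence underlying A contains (a, b) exactly A (a, b) times. *)
Definition matM := {mset (nat * nat)%type}%mset.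

(* The pairs (i_m, j_m). *)
Definition biword_ij (A : matM) : seq (nat * nat) :=
  sort (fun x y : nat * nat =>
          (x.2 < y.2)%N || (x.2 == y.2) && (y.1 <= x.1)%N) (enum_mset A).
(* The pairs (k_m, l_m). *)
Definition biword_kl (A : matM) : seq (nat * nat) :=
  sort (fun x y : nat * nat =>
          (x.1 < y.1)%N || (x.1 == y.1) && (y.2 <= x.2)%N) (enum_mset A).

Definition word_i (A : matM) : words Bneg_dual := unzip1 (biword_ij A).
Definition word_j (A : matM) : seq nat := unzip2 (biword_ij A).
Definition word_k (A : matM) : seq nat := unzip1 (biword_kl A).
Definition word_l (A : matM) : words Bpos := unzip2 (biword_kl A).

Definition M_wt (A : matM) : weight :=
  \sum_(x <- finsupp A) (- epsilon (zneg x.1) + epsilon (zpos x.2)) *+ A x.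

Definition M_eps (i : int) (A : matM) : zbar :=
  if i < 0 then eps i (word_i A)
  else if 0 < i then eps i (word_l A)
  else Some (A (0, 0)%N)%:Z.

Definition M_phi (i : int) (A : matM) : zbar :=
  if i < 0 then phi i (word_i A)
  else if 0 < i then phi i (word_l A)
  else zadd (M_eps 0 A) (pairing (M_wt A) 0).

Definition M_et (i : int) (A : matM) : option matM :=
  if i < 0 then omap (fun u => seq_mset (zip u (word_j A))) (et i (word_i A))
  else if 0 < i then
    omap (fun u => seq_mset (zip (word_k A) u)) (et i (word_l A))
  else if A (0, 0)%N != 0%N then Some (A `\` [mset (0, 0)%N])%mset else None.

Definition M_ft (i : int) (A : matM) : option matM :=
  if i < 0 then omap (fun u => seq_mset (zip u (word_j A))) (ft i (word_i A))
  else if 0 < i then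
    omap (fun u => seq_mset (zip (word_k A) u)) (ft i (word_l A))
  else Some (A `+` [mset (0, 0)%N])%mset.

Definition Mcal : precrystal := {|
  carrier := matM;
  wt := M_wt;
  eps := M_eps;
  phi := M_phi;
  et := M_et;
  ft := M_ft |}.

(** * Tableaux and kappa *)

(* A tableau of shape nu^pi is the sequence of its nonempty columns, from
   right to left, each of them read from top to bottom. *)
Definition tableau := seq (seq nat).

(* T <- a; c is the rightmost column. *)
Fixpoint insertion (T : tableau) (a : nat) : tableau :=
  if T is c :: T' then
    if has (fun x => x <= a)%N c then
      let a' := (\max_(x <- c | x <= a) x)%N in
      [seq if x == a' then a else x | x <- c] :: insertion T' a'
    else (a :: c) :: T'
  else [:: [:: a]].

Definition Ptab (w : seq nat) : tableau := foldl insertion [::] w.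

Definition kappa (A : matM) : tableau * tableau :=
  (Ptab (rev (word_i A)), Ptab (rev (word_l A))).

(* kappa is a bijection onto the set of pairs (P, Q) of semistandard tableaux
   of a common shape nu^pi.  Its inverse sends (P, Q) to the A such that
   kappa A = (P, Q); the value mset0 is only taken when there is none. *)
Definition kappa_inv (PQ : tableau * tableau) : matM :=
  xget mset0 [set A | kappa A = PQ]%classic.

(** * The crystal B(n Lambda_0) *)

(* w m is the letter w_{-(m+1)} of the semi-infinite word
   ... w_{-3} w_{-2} w_{-1}. *)
Definition has_charge (c : int) (w : nat -> zstar) : Prop :=
  exists N : nat, forall m : nat, (N <= m)%N -> val (w m) = - m.+1%:Z + c.

Definition semi_infinite (w : nat -> zstar) : Prop :=
  (forall m : nat, val (w m.+1) < val (w m)) /\ exists c, has_charge c w.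

Definition is_siword : pred (nat -> zstar) := fun w => `[< semi_infinite w >].
Definition siword := {w : nat -> zstar | is_siword w}.

Definition occurs (k : zstar) (w : siword) : bool :=
  `[< exists m, val w m = k >].

(* m_k; a letter occurs at most once in w. *)
Definition mult (w : siword) (k : zstar) : int :=
  b2z (occurs k w) - b2z (val k < 0).

Definition replace_letter (a b : zstar) (w : siword) : nat -> zstar :=
  fun m => if val w m == a then b else val w m.

(* [insub] only repackages the new word, which is always semi-infinite. *)
Definition to_siword (w : nat -> zstar) : option siword := insub w.

Definition Fcal : precrystal := {|
  carrier := siword;
  wt w := Lambda0 +
    (\sum_(k \in [set: zstar]%classic) epsilon k *~ mult w k);
  eps i w := Some (b2z (occurs (lq i) w && ~~ occurs (lp i) w));
  phi i w := Some (b2z (occurs (lp i) w && ~~ occurs (lq i) w));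
  et i w := if occurs (lq i) w && ~~ occurs (lp i) w
            then to_siword (replace_letter (lq i) (lp i) w) else None;
  ft i w := if occurs (lp i) w && ~~ occurs (lq i) w
            then to_siword (replace_letter (lp i) (lq i) w) else None |}.

Definition in_BnLambda0 (n : nat) (ws : words Fcal) : bool :=
  [&& size ws == n,
      all (fun w : siword => `[< has_charge 0 (val w) >]) ws
    & sorted (fun u v : siword => `[< forall m, val (val v m) <= val (val u m) >])
        ws].

Definition BnLambda0 (n : nat) : precrystal := subcrystal (@in_BnLambda0 n).

(** * The map Psi_n *)

(* The elements of a finite set in increasing order. *)
Definition column (A : set nat) : seq nat := sort leq (fset_set A).

Definition nonempty_columns (T : seq (seq nat)) : tableau :=
  [seq c <- T | c != [::]].

Definition pos_part (ws : seq siword) : tableau :=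
  nonempty_columns
    [seq column [set m | occurs (zpos m) w]%classic | w <- ws].

Definition neg_dual_part (ws : seq siword) : tableau :=
  nonempty_columns
    [seq column [set m | ~~ occurs (zneg m) w]%classic | w <- ws].

Definition Psi (n : nat)
    (x : tensor (BnLambda0 n) (Tcrystal (- (Lambda0 *+ n)))) : Mcal :=
  kappa_inv (neg_dual_part (val x.1), pos_part (val x.1)).

(* Main.v *)
(* Inserting the biword of a matrix A into a single column yields a column q, a
   recording column p and a biword of bumped letters, i.e. a matrix A'; since
   kappa A is obtained by iterating A |-> (p, q, A'), everything is proved one
   column at a time.  In the manner of Viennot's shadow lines, A' and (p, q) are
   computed by a local rule at each cell of the plane, processed from the far
   corner towards (0, 0).  The rule is symmetric, hence the symmetry of kappa;
   it is an involution, hence the injectivity of kappa; and (0, 0) is the last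
   cell, where the rule is the tensor product rule for i = 0.  For i > 0 the map
   A |-> q (x) A' obeys the tensor product rule already for the insertion of
   one letter, and i < 0 follows by transposition.  Thus kappa A = (w^v_{<0},
   w_{>0}) implies the same relation after applying f_i to both sides; as the
   vacuum corresponds to the zero matrix and generates B(n Lambda_0) under the
   f_i, every w has such an A, which is then Psi_n w. *)

Require Import Defs.
From mathcomp Require Import all_boot all_order all_algebra.
From mathcomp Require Import finmap multiset.
From mathcomp Require Import freeg.
From mathcomp Require Import boolp classical_sets cardinality fsbigop.
From mathcomp Require Import zify.

Set Implicit Arguments.
Unset Strict Implicit.
Unset Printing Implicit Defensive.

Import Order.TTheory GRing.Theory Num.Theory.
Local Open Scope ring_scope.

(** * Crystals at a single index *)

(** No inverse insertion is constructed, and the tableaux of an element of B(n Lambda_0) are never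
    examined for their shape. The obstacle is that such an element has exactly n columns, some
    possibly empty, while tableaux drop empty columns. The relation [layered] therefore compares a
    matrix with a list of column pairs in which empty pairs are kept, so that it can be matched with
    the tuple factor by factor. Most statements about e_i and phi_i are derived: e_i inverts f_i by
    axiom (4), and phi_i follows from eps_i and the weight by axiom (1). Beyond the axioms, two
    facts are needed about e_i on tuples: it preserves the inequalities between columns, and some
    e_i is nonzero unless every column is the vacuum. *)

Lemma pairingD (x y : weight) i : pairing (x + y) i = pairing x i + pairing y i.
Proof.
rewrite /pairing /= !coeffD opprD [X in X + _]addrACA [RHS]addrACA.
by case: eqP; rewrite ?addr0.
Qed.

Lemma pairingN (x : weight) i : pairing (- x) i = - pairing x i.
Proof.
by rewrite /pairing /= !coeffN !opprD; case: eqP => _; rewrite ?oppr0.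
Qed.

Lemma pairing0 i : pairing 0 i = 0.
Proof. by rewrite /pairing /= !coeff0; case: eqP. Qed.

Lemma lp_neq_lq i : (lp i == lq i) = false.
Proof. by apply/negP => /eqP/(congr1 val) /=; case: i => [[|m]|m] /=; lia. Qed.

Lemma coeff_epsilon (k l : zstar) : coeff k (epsilon l).1 = (l == k)%:Z.
Proof. by rewrite /= coeffU mul1r; case: eqP. Qed.

Lemma pairing_epsilon k i :
  pairing (epsilon k) i = (k == lp i)%:Z - (k == lq i)%:Z.
Proof. by rewrite /pairing !coeff_epsilon /= if_same addr0. Qed.

Lemma pairing_alpha i : pairing (alpha i) i = 2.
Proof.
rewrite /alpha pairingD pairingN !pairing_epsilon !eqxx.
by rewrite lp_neq_lq eq_sym lp_neq_lq.
Qed.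

(** The letters satisfy the axioms only at the indices of their own arrows: at i = 0 the letter 1
    has eps = phi = 0 but pairs to -1 with h_0. Hence the axioms are isolated index by index. *)
Record crystal_at (B : precrystal) (i : int) : Prop := CrystalAt {
  at_phi : forall b : B, phi i b = zadd (eps i b) (pairing (wt b) i);
  at_et : forall b b' : B, et i b = Some b' ->
    [/\ eps i b' = zadd (eps i b) (- 1), phi i b' = zadd (phi i b) 1
      & wt b' = wt b + alpha i];
  at_ft : forall b b' : B, ft i b = Some b' ->
    [/\ eps i b' = zadd (eps i b) 1, phi i b' = zadd (phi i b) (- 1)
      & wt b' = wt b - alpha i];
  at_etft : forall b b' : B, ft i b = Some b' <-> et i b' = Some b;
  at_ninfty : forall b : B, phi i b = None -> et i b = None /\ ft i b = None }.

Lemma crystal_atP (B : precrystal) : is_crystal B <-> forall i, crystal_at B i.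
Proof.
split=> [[H1 H2 H3 H4 H5] i | H]; first by split; eauto.
by split=> i; case: (H i).
Qed.

Lemma words_phi (B : precrystal) i (s : seq B) : crystal_at B i ->
  word_phi i s = zadd (word_eps i s) (pairing (word_wt s) i).
Proof.
move=> HB; elim: s => [|b s IHs] /=.
  by rewrite /word_wt big_nil pairing0.
rewrite /word_wt big_cons -/(word_wt s) (at_phi HB) IHs pairingD.
case: (eps i b) (word_eps i s) => [x|] [y|] //=; rewrite /zmax /=;
  (do 2?case: ifP => //=); move=> *; congr Some; lia.
Qed.

Lemma word_eps_fin (B : precrystal) i (s : seq B) : word_eps i s != None.
Proof.
elim: s => //= b s; case: (word_eps i s) => // x _; rewrite /zmax.
by case: (eps i b) => [y|] //=; case: ifP.
Qed.

Lemma words_crystal_at (B : precrystal) i :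
  crystal_at B i -> crystal_at (words B) i.
Proof.
move=> HB; have Hphi := fun s => words_phi s HB.
have Het (b b' : words B) : et i b = Some b' ->
    [/\ eps i b' = zadd (eps i b) (- 1), phi i b' = zadd (phi i b) 1
      & wt b' = wt b + alpha i].
  (* Axiom (1) gives phi from eps and the weight, and alpha_i pairs to 2 with h_i, so the induction
     concerns only eps and the weight. *)
  rewrite /= !Hphi; suff H : word_et i b = Some b' ->
      word_eps i b' = zadd (word_eps i b) (- 1) /\
      word_wt b' = word_wt b + alpha i.
    move=> /H [-> ->]; split=> //; rewrite pairingD pairing_alpha.
    by case: word_eps => //= x; congr Some; lia.
  elim: b b' => //= b s IHs s'; rewrite (at_phi HB).
  case: ifP => Hle.
    case Eb: (et i b) => [b1|] //= [<-] /=; have [-> _ Ewt] := at_et HB Eb.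
    rewrite /word_wt !big_cons Ewt addrAC; split=> //.
    rewrite pairingD pairing_alpha; move: Hle (word_eps_fin i s).
    case: (eps i b) (word_eps i s) => [x|] [y|] //= Hle _.
    by rewrite /zmax /=; case: ifP => ?; case: ifP => ? /=; congr Some; lia.
  case Es: (word_et i s) => [s1|] //= [<-] /=.
  have [-> Ewt] := IHs _ Es;
    rewrite /word_wt !big_cons -!/(word_wt _) Ewt addrA.
  split=> //; move: Hle (word_eps_fin i s).
  case: (eps i b) (word_eps i s) => [x|] [y|] //= Hle _; rewrite /zmax /=;
  (do 2?case: ifP => //=); move=> *; congr Some; lia.
have Hft (b b' : words B) : ft i b = Some b' ->
    [/\ eps i b' = zadd (eps i b) 1, phi i b' = zadd (phi i b) (- 1)
      & wt b' = wt b - alpha i].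
  rewrite /= !Hphi; suff H : word_ft i b = Some b' ->
      word_eps i b' = zadd (word_eps i b) 1 /\
      word_wt b' = word_wt b - alpha i.
    move=> /H [-> ->]; split=> //; rewrite pairingD pairingN pairing_alpha.
    by case: word_eps => //= x; congr Some; lia.
  elim: b b' => //= b s IHs s'; rewrite (at_phi HB).
  case: ifP => Hle.
    case Eb: (ft i b) => [b1|] //= [<-] /=; have [-> _ Ewt] := at_ft HB Eb.
    rewrite /word_wt !big_cons Ewt addrAC; split=> //.
    rewrite pairingD pairingN pairing_alpha; move: Hle (word_eps_fin i s).
    case: (eps i b) (word_eps i s) => [x|] [y|] //= Hle _.
    by rewrite /zmax /=; case: ifP => ?; case: ifP => ? /=; congr Some; lia.
  case Es: (word_ft i s) => [s1|] //= [<-] /=.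
  have [-> Ewt] := IHs _ Es;
    rewrite /word_wt !big_cons -!/(word_wt _) Ewt addrA.
  split=> //; move: Hle (word_eps_fin i s).
  case: (eps i b) (word_eps i s) => [x|] [y|] //= Hle _; rewrite /zmax /=;
  (do 2?case: ifP => //=); move=> *; congr Some; lia.
split=> //.
(* Acting on either factor shifts the comparison of phi(head) with eps(tail) by one, which exchanges
   the weak inequality of e_i and the strict one of f_i; so the inverse operator picks the same
   factor. *)
- move=> s s'; split.
    elim: s s' => //= b s IHs s'; case: ifP => Hle.
      case Eb: (ft i b) => [b1|] //= [<-] /=; have [_ Ephi _] := at_ft HB Eb.
      have -> : zle (word_eps i s) (phi i b1).
        rewrite Ephi; move: Hle (word_eps_fin i s).
        by case: (phi i b) (word_eps i s) => [x|] [y|] //=; lia.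
      by rewrite (proj1 (at_etft HB _ _) Eb).
    case Es: (word_ft i s) => [s1|] //= [<-] /=.
    have [/= -> _ _] := Hft _ _ Es; rewrite (IHs _ Es).
    suff -> : zle (zadd (word_eps i s) 1) (phi i b) = false by [].
    move: Hle (word_eps_fin i s).
    by case: (phi i b) (word_eps i s) => [x|] [y|] //=; lia.
  elim: s' s => //= b s IHs s'; case: ifP => Hle.
    case Eb: (et i b) => [b1|] //= [<-] /=; have [_ Ephi _] := at_et HB Eb.
    rewrite Ephi; have -> : zle (zadd (phi i b) 1) (word_eps i s) = false.
      move: Hle (word_eps_fin i s).
      by case: (phi i b) (word_eps i s) => [x|] [y|] //=; lia.
    by rewrite /= (proj2 (at_etft HB _ _) Eb).
  case Es: (word_et i s) => [s1|] //= [<-] /=.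
  have [/= -> _ _] := Het _ _ Es; rewrite (IHs _ Es).
  suff -> : zle (phi i b) (zadd (word_eps i s) (-1)) by [].
  move: Hle (word_eps_fin i s).
  by case: (phi i b) (word_eps i s) => [x|] [y|] //=; lia.
- move=> s /=; rewrite Hphi => Hs; case: notF.
  by move: Hs (word_eps_fin i s); case: word_eps.
Qed.

(** As eps and phi of t are -oo, the operators act on the left factor. The rule for f_i turns to the
    right only if phi_i(b) = -oo, and then axiom (5) makes both answers 0. *)
Lemma tensorT_crystal (B : precrystal) lam :
  is_crystal B -> is_crystal (tensor B (Tcrystal lam)).
Proof.
move=> HB; have Hz x : zmax x None = x by case: x.
have Hn x : zle x None = (x == None) by case: x.
have Hn2 i (b : B) : phi i b == None -> ft i b = None.
  by move/eqP => /(crystal_ninfty HB) [].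
have Hft i (x : tensor B (Tcrystal lam)) :
    ft i x = omap (fun b => (b, tt)) (ft i x.1).
  by case: x => b [] /=; rewrite Hn; case: eqP => //= /eqP/Hn2 ->.
split=> /=.
- move=> i [b []] /=; rewrite /zmax (crystal_phi HB) pairingD /=.
  by case: (eps i b) => //= x; congr Some; lia.
- move=> i [b []] b' /=; case Eb: (et i b) => [b1|] //= [<-] /=.
  have [-> -> ->] := crystal_et HB Eb; split; rewrite ?Hz //.
    by rewrite /zmax; case: (phi i b) => //= x; congr Some; lia.
  by rewrite addrAC.
- move=> i b b'; rewrite [LHS]Hft; case: b => b [] /=.
  case Eb: (ft i b) => [b1|] //= [<-] /=.
  have [-> -> ->] := crystal_ft HB Eb; split; rewrite ?Hz //.
    by rewrite /zmax; case: (phi i b) => //= x; congr Some; lia.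
  by rewrite addrAC.
- move=> i b b'; rewrite [X in X = _]Hft; case: b b' => b [] [b' []] /=.
  split.
    case Eb: (ft i b) => [b1|] //= [<-].
    by rewrite (proj1 (crystal_etft HB _ _ _) Eb).
  case Eb: (et i b') => [b1|] //= [<-].
  by rewrite (proj2 (crystal_etft HB _ _ _) Eb).
- move=> i b; rewrite [X in _ /\ X = _]Hft; case: b => b [] /=; rewrite Hz => H.
  have /(crystal_ninfty HB) [-> ->] // : phi i b = None.
  by move: H; case: phi.
Qed.

Lemma subcrystal_crystal (B : precrystal) (S : pred B) :
  is_crystal B -> is_crystal (subcrystal S).
Proof.
move=> HB.
have Het i (b b' : subcrystal S) : et i b = Some b' <-> et i (val b) = Some (val
  b').
  rewrite /=; case: (et i (val b)) => [b1|] //=.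
  split; first by case: insubP => // u _ <- [->].
  by case=> ->; rewrite valK.
have Hft i (b b' : subcrystal S) : ft i b = Some b' <-> ft i (val b) = Some (val
  b').
  rewrite /=; case: (ft i (val b)) => [b1|] //=.
  split; first by case: insubP => // u _ <- [->].
  by case=> ->; rewrite valK.
split.
- by move=> i b; apply: (crystal_phi HB).
- by move=> i b b' /Het /(crystal_et HB).
- by move=> i b b' /Hft /(crystal_ft HB).
- by move=> i b b'; rewrite Het Hft; apply: (crystal_etft HB).
- by move=> i b /= /(crystal_ninfty HB) [-> ->].
Qed.

(** * Column insertion and shadow lines *)

Definition column_insert (q : seq nat) (a : nat) : seq nat * option nat :=
  if has (fun x => x <= a)%N q then
    let m := (\max_(x <- q | x <= a) x)%N in
    ([seq if x == m then a else x | x <- q], Some m)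
  else (a :: q, None).

Variant column_insert_spec (q : seq nat) (a : nat) :
    seq nat * option nat -> Prop :=
  | ColumnGrows of (forall x, x \in q -> a < x)%N :
      column_insert_spec q a (a :: q, None)
  | ColumnBumps m of m \in q & (m <= a)%N
      & (forall x, x \in q -> x <= a -> x <= m)%N :
      column_insert_spec q a ([seq if x == m then a else x | x <- q], Some m).

Lemma bigmax_seq_mem (q : seq nat) (P : pred nat) :
  has P q -> let m := (\max_(x <- q | P x) x)%N in (m \in q) && P m.
Proof.
elim: q => //= y q IHq; rewrite big_cons.
case: ifP => [Py _|Py /= /IHq /andP [mq ->]]; last by rewrite inE mq orbT.
case: (boolP (has P q)) => [/IHq /andP [mq Pm]|/hasPn nq].
  by rewrite /maxn; case: ifP => _; rewrite inE ?mq ?eqxx ?orbT.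
rewrite [X in maxn _ X]big_seq_cond big1 => [|x /andP [/nq /negPf -> //]].
by rewrite maxn0 mem_head.
Qed.

Lemma column_insertP q a : column_insert_spec q a (column_insert q a).
Proof.
rewrite /column_insert; case: ifP => [Hq|/negbT/hasPn Hq].
  have /andP [mq ma] := bigmax_seq_mem Hq.
  by apply: ColumnBumps => // x xq xa;
    exact: (@leq_bigmax_seq _ q (leq^~ a) (fun x => x)).
by constructor=> x /Hq; rewrite -ltnNge.
Qed.

Lemma mem_column_bump q m a x : m \in q -> (forall y, y \in q -> y <= a ->
  y <= m)%N ->
  (m <= a)%N ->
  (x \in [seq if y == m then a else y | y <- q]) = (x == a) || (x \in q) && (x
    != m).
Proof.
move=> mq Hm ma; apply/mapP/idP =>
  [[y yq ->]|/orP [/eqP ->|/andP [xq /negPf xm]]].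
- by case: (eqVneq y m) => ym; rewrite ?eqxx ?yq ?ym ?orbT.
- by exists m; rewrite ?eqxx.
- by exists x => //; rewrite xm.
Qed.

(** No entry of [q] lies above m and at most a, so raising m to a passes no other entry. *)
Lemma sorted_column_bump q m a : sorted ltn q -> m \in q ->
  (forall y, y \in q -> y <= a -> y <= m)%N -> (m <= a)%N ->
  sorted ltn [seq if y == m then a else y | y <- q].
Proof.
move=> Hq mq Hm ma; rewrite sorted_map.
apply: (@sub_in_sorted _ (mem q) ltn) Hq; last exact/allP.
move=> x y xq yq /= xy; have := Hm y yq.
by case: (x =P m) xy => [->|_]; case: (y =P m) => [->|_] //; lia.
Qed.

(** The first coordinate stays with the bumped letter, so that [t] is again a biword; when the
    column grows, it is recorded in [p]. *)
Definition pass_step (x : nat * nat)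
    (st : seq nat * seq nat * seq (nat * nat)) :=
  let: (p, q, t) := st in
  match column_insert q x.2 with
  | (q', Some b) => (p, q', (x.1, b) :: t)
  | (q', None) => (x.1 :: p, q', t)
  end.

(** A right fold, because [kappa] inserts reversed words: the last pair enters first. *)
Definition pass (s : seq (nat * nat)) := foldr pass_step ([::], [::], [::]) s.

Lemma insertion_cons c T a : insertion (c :: T) a =
  match column_insert c a with
  | (c', Some b) => c' :: insertion T b
  | (c', None) => c' :: T
  end.
Proof. by rewrite /= /column_insert; case: ifP. Qed.

(** The columns after the first see only the letters bumped out of it, in the order of bumping. The
    empty word is separate because it has no column at all. *)
Lemma Ptab_pass s : Ptab (rev (unzip2 s)) =
  let: (p, q, t) := pass s in
  if s is [::] then [::] else q :: Ptab (rev (unzip2 t)).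
Proof.
have PtabE w a : Ptab (rev (a :: w)) = insertion (Ptab (rev w)) a.
  by rewrite /Ptab rev_cons -cats1 foldl_cat.
elim: s => [|x [|y s] IHs] //; rewrite [LHS]PtabE {}IHs.
rewrite -[pass [:: x, y & s]]/(pass_step x (pass (y :: s))).
case: (pass (y :: s)) => [[p q] t]; rewrite insertion_cons /=.
by case: column_insertP => //= m; rewrite PtabE.
Qed.

Lemma pass_eq_nil s : let: (p, q, t) := pass s in (q == [::]) = (s == [::]).
Proof.
elim: s => //= x s; case: (pass s) => [[p q] t] /= Hq.
by case: column_insertP => // m; case: (q).
Qed.

(* The local rule at a lattice cell: h and v mark the edges crossed by the
   shadow lines.  Lines enter a cell from the right or from below, and leave
   it to the left or upwards; a is the multiplicity of the cell in the matrix,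
   and the last component is its multiplicity in the bumped matrix. *)
Definition cell (right below : bool) (a : nat) : bool * bool * nat :=
  match right, below, a with
  | true, true, _ => (false, false, a.+1)
  | false, false, a'.+1 => (true, true, a')
  | false, false, 0%N => (false, false, 0%N)
  | _, _, _ => (right, below, a)
  end.

Lemma cellK r b a : let: (l, u, a') := cell r b a in cell l u a' = (r, b, a).
Proof. by case: r b a => [] [] []. Qed.

Lemma cellC r b a : cell b r a = let: (l, u, a') := cell r b a in (u, l, a').
Proof. by case: r b a => [] [] []. Qed.

(** [h i j] is the left edge and [v i j] the upper edge of the cell (i, j). The bound N says that no
    line comes in from infinity, which makes the diagram a function of A. *)
Definition shadows (A A' : nat -> nat -> nat) (h v : nat -> nat -> bool) :=
  (forall i j, cell (h i j.+1) (v i.+1 j) (A i j) = (h i j, v i j, A' i j)) /\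
  exists N, forall i j, (N <= i + j)%N -> h i j = false /\ v i j = false.

(** [p] holds the rows in which lines leave through the left border, [q] the columns in which they
    leave through the top. *)
Definition scan (A : nat -> nat -> nat) (p q : seq nat) (A' : nat -> nat ->
  nat) :=
  exists h v, [/\ shadows A A' h v, forall i, h i 0%N = (i \in p)
                & forall j, v 0%N j = (j \in q)].

Lemma scan_tr A p q A' : scan A p q A' ->
  scan (fun i j => A j i) q p (fun i j => A' j i).
Proof.
move=> [h [v [[Hc [N HN]] Hp Hq]]];
  exists (fun i j => v j i), (fun i j => h j i).
split=> //; split=> [i j|]; first by rewrite cellC Hc.
by exists N => i j; rewrite addnC => /HN [].
Qed.

(** The edges entering a cell lie on the next antidiagonal, so the induction runs towards the origin
    from an antidiagonal beyond which both diagrams are empty. *)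
Lemma shadows_fun A A' h v B B' h1 v1 : shadows A A' h v ->
  shadows B B' h1 v1 ->
  A =2 B -> [/\ h =2 h1, v =2 v1 & A' =2 B'].
Proof.
move=> [Hc [N HN]] [Hc1 [N1 HN1]] AB.
suff H i j : h i j = h1 i j /\ v i j = v1 i j.
  split=> i j; try by case: (H i j).
  by have := Hc1 i j; rewrite -(H i j.+1).1 -(H i.+1 j).2 -AB Hc => -[].
move: {2}(N + N1 - (i + j))%N (leqnn (N + N1 - (i + j)))%N => n.
elim: n i j => [|n IHn] i j Hn.
  have [|-> ->] := HN i j; first lia.
  by have [|-> ->] := HN1 i j; first lia.
case: (leqP (N + N1) (i + j)) => Hij; first by apply: IHn; lia.
have := Hc i j; have := Hc1 i j.
have [|-> _] := IHn i j.+1; first lia.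
have [|_ ->] := IHn i.+1 j; first lia.
by rewrite AB => -> [].
Qed.

Lemma scan_fun A p q A' p1 q1 A1 : scan A p q A' -> scan A p1 q1 A1 ->
  [/\ p =i p1, q =i q1 & A' =2 A1].
Proof.
move=> [h [v [H Hp Hq]]] [h1 [v1 [H1 Hp1 Hq1]]].
have [Eh Ev EA] := shadows_fun H H1 (fun i j => erefl).
by split=> // x; [rewrite -Hp -Hp1 Eh | rewrite -Hq -Hq1 Ev].
Qed.

(** By [cellK] the leaving edges and the bumped entry determine the entering edges and the original
    entry, so the diagram is rebuilt from the borders outwards. *)
Lemma scan_inj A p q A' B p1 q1 B' : scan A p q A' -> scan B p1 q1 B' ->
  p =i p1 -> q =i q1 -> A' =2 B' -> A =2 B.
Proof.
move=> [h [v [[H _] Hp Hq]]] [h1 [v1 [[H1 _] Hp1 Hq1]]] Ep Eq EA.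
have back i j : h i j = h1 i j -> v i j = v1 i j ->
    [/\ h i j.+1 = h1 i j.+1, v i.+1 j = v1 i.+1 j & A i j = B i j].
  move=> Eh Ev.
  have := cellK (h i j.+1) (v i.+1 j) (A i j).
  have := cellK (h1 i j.+1) (v1 i.+1 j) (B i j).
  by rewrite H H1 Eh Ev EA => -> [].
suff E i j : h i j = h1 i j /\ v i j = v1 i j.
  by move=> i j; have [Eh Ev] := E i j; case: (back i j).
move: {2}(i + j)%N (leqnn (i + j)%N) => n.
elim: n i j => [|n IHn] i j Hn.
  have [-> ->] : i = 0%N /\ j = 0%N by lia.
  by rewrite Hp Hp1 Hq Hq1.
split.
  case: j Hn => [|j] Hn; first by rewrite Hp Hp1.
  by have [|Eh Ev] := IHn i j; [lia | case: (back i j)].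
case: i Hn => [|i] Hn; first by rewrite Hq Hq1.
by have [|Eh Ev] := IHn i j; [lia | case: (back i j)].
Qed.

(** A horizontal line in the empty end of a row would have to come from infinity; there is none, so
    vertical lines pass straight through. *)
Lemma shadows_row A A' h v i a : shadows A A' h v ->
  (forall j, a <= j -> A i j = 0%N)%N ->
  forall j, (a <= j)%N -> [/\ h i j = false, v i j = v i.+1 j & A' i j = 0%N].
Proof.
move=> [Hc [N HN]] HA.
have Hh j : (a <= j)%N -> h i j = false.
  move: {2}(N - j)%N (leqnn (N - j)%N) => n.
  elim: n j => [|n IHn] j Hn aj; first by have [|] := HN i j; lia.
  have := Hc i j; rewrite HA // IHn; [|lia..].
  by case: (v i.+1 j) => [] [].
move=> j aj; have := Hc i j; rewrite HA // !Hh; [|lia..].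
by case: (v i.+1 j) => [] [].
Qed.

(** * Shadow lines of a sorted biword *)

Definition kl_le (x y : nat * nat) : bool :=
  (x.1 < y.1)%N || (x.1 == y.1) && (y.2 <= x.2)%N.

Definition entries (s : seq (nat * nat)) (i j : nat) : nat :=
  count_mem (i, j) s.

Lemma entries_eq0 s i j : (entries s i j == 0)%N = ((i, j) \notin s).
Proof. by rewrite -leqn0 -has_pred1 has_count leqNgt. Qed.

Lemma kl_le_trans : transitive kl_le.
Proof. by move=> [a b] [c d] [e f]; rewrite /kl_le /=; lia. Qed.

Lemma kl_le_total : total kl_le.
Proof. by move=> [a b] [c d]; rewrite /kl_le /=; lia. Qed.

Lemma kl_le_anti : antisymmetric kl_le.
Proof.
by move=> [a b] [c d]; rewrite /kl_le /= => H; congr (_, _); lia.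
Qed.

(** The head (k, a) lies in the topmost occupied row and weakly to the right of the other points
    there, so adding it disturbs only row k and the vertical edges above it. The last clause
    describes v in every row at or above all points, not only at the border, because the induction
    reads [q] off row k. *)
Lemma pass_shadows s : sorted kl_le s -> let: (p, q, t) := pass s in
  [/\ sorted ltn p, sorted ltn q, sorted kl_le t
    & exists h v, [/\ shadows (entries s) (entries t) h v,
        forall i, h i 0%N = (i \in p)
      & forall i j, (forall x, x \in s -> i <= x.1)%N -> v i j = (j \in q)]].
Proof.
elim: s => [|[k a] s IHs] /=.
  move=> _; split=> //; exists (fun _ _ => false), (fun _ _ => false).
  by split=> //; split; last by exists 0%N.
rewrite (path_sortedE kl_le_trans) => /andP [/allP Hka /[dup] Hs {}/IHs].
case: (pass s) => [[p q] t] [Hp Hq Ht [h [v [Hsh Hhp Hvq]]]].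
have vk j : v k j = (j \in q).
  by apply: Hvq => -[x y] /Hka; rewrite /kl_le /=; lia.
have low i j : (i < k)%N ->
    [/\ h i j = false, v i j = v i.+1 j, entries s i j = 0%N &
      entries t i j = 0%N].
  move=> ik; have Es j' : entries s i j' = 0%N.
    by apply/eqP; rewrite entries_eq0; apply/negP => /Hka; rewrite /kl_le /=;
      lia.
  by have [//|//|] := shadows_row Hsh (i := i) (a := 0) _ (j := j).
have right j : (a < j)%N ->
    [/\ h k j = false, v k j = v k.+1 j, entries s k j = 0%N &
      entries t k j = 0%N].
  have Es j' : (a < j')%N -> entries s k j' = 0%N.
    move=> aj; apply/eqP; rewrite entries_eq0; apply/negP => /Hka;
      rewrite /kl_le /=; lia.
  by move=> aj; have [//|//|] := shadows_row Hsh (i := k) (a := a.+1) _ (j :=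
    j);
    rewrite Es.
have [Hc HN] := Hsh.
(* If no letter of [q] lies in [m, a], row k carries no line and no point in that range: a point, or
   a line from below, would leave through an upper edge, whose column belongs to [q]. *)
have gap m : (forall x, m <= x -> x <= a -> x \notin q)%N ->
    forall j, (m <= j)%N -> (j <= a)%N ->
    [/\ h k j = false, h k j.+1 = false, v k.+1 j = false, entries s k j = 0%N
      & entries t k j = 0%N].
  move=> Hm j; move: {2}(a - j)%N (leqnn (a - j)%N) => n.
  elim: n j => [|n IHn] j Hn mj ja.
    have E : j = a by lia.
    have [//|r _ _ _] := right j.+1; first by rewrite E.
    have := Hc k j; rewrite r vk (negPf (Hm _ _ _)) //.
    by case: (v k.+1 j) (entries s k j) => [] [|?] //= [] <- <-.
  case: (ltnP j a) => ja'; last by apply: IHn => //; lia.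
  have [|||r _ _ _ _] := IHn j.+1; try lia.
  have := Hc k j; rewrite r vk (negPf (Hm _ _ _)) //.
  by case: (v k.+1 j) (entries s k j) => [] [|?] //= [] <- <-.
rewrite /=; case: column_insertP => [Ha|m mq ma Hm].
  have g0 x : (0 <= x)%N -> (x <= a)%N -> x \notin q.
    by move=> _ xa; apply/negP => /Ha; lia.
  have {g0}gap := gap _ g0.
  have kp : k \notin p by rewrite -Hhp; have [//|//|->] := gap 0%N.
  split=> //.
  - rewrite /= (path_sortedE ltn_trans) Hp andbT; apply/allP => i /= ip.
    rewrite ltn_neqAle leqNgt; apply/andP; split.
      by apply: contraNneq kp => ->.
    by apply/negP => ik; move: ip; rewrite -Hhp; have [//|->] := low i 0%N.
  - by rewrite /= (path_sortedE ltn_trans) Hq andbT; apply/allP => x /Ha.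
  (* The new point sends one line up column a and one left along row k; the latter meets no vertical
     line and reaches the border, where [p] records k. *)
  exists (fun i j => h i j || (i == k) && (j <= a)%N),
    (fun i j => if (i <= k)%N then j \in a :: q else v i j).
  split.
  - split; last first.
      (* Beyond this bound, a cell in a row up to k lies to the right of a and of every letter of
         [q]. *)
      have [N HN'] := HN; exists (N + k + a + (\max_(x <- q) x) + 1)%N =>
        i j Hij.
      have [|-> ->] := HN' i j; first lia.
      split; first lia.
      case: ifP => // ik; rewrite inE; apply/negP => /orP [|jq]; first lia.
      by have := @leq_bigmax_seq _ q xpredT (fun x => x) j jq isT; rewrite /=;
        lia.
    move=> i j; rewrite /entries /= -!/(entries _ _ _).
    case: (ltngtP i k) => ik /=.
    - have [-> _ -> ->] := low i j ik; have [-> _ _ _] := low i j.+1 ik.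
      rewrite (_ : (k, a) == (i, j) = false); last by apply/eqP => -[]; lia.
      by case: (j \in _).
    - rewrite !orbF -Hc.
      by rewrite (_ : (k, a) == (i, j) = false) //; apply/eqP => -[]; lia.
    - subst i; rewrite inE xpair_eqE eqxx /= [a == j]eq_sym.
      case: (ltngtP j a) => ja /=.
      + have [||r1 r2 r3 r4 r5] := gap j; [lia..|].
        rewrite r1 r2 r3 r4 r5 (negPf (_ : j \notin q)) //=.
        by apply/negP => /Ha; lia.
      + by rewrite !orbF -vk -Hc.
      + subst j; have [||r1 r2 r3 r4 r5] := gap a; [lia..|].
        by rewrite r1 r2 r3 r4 r5.
  - by move=> i; rewrite Hhp inE andbT orbC.
  - by move=> i j Hi; rewrite (Hi (k, a) (mem_head _ _)).
have g0 x : (m.+1 <= x)%N -> (x <= a)%N -> x \notin q.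
  by move=> mx xa; apply/negP => xq; have := Hm x xq xa; lia.
have {g0}gap := gap _ g0.
split=> //.
- exact: sorted_column_bump.
- rewrite /= (path_sortedE kl_le_trans) Ht andbT; apply/allP => -[i j] ijt.
  have {ijt} : entries t i j != 0%N by rewrite entries_eq0 ijt.
  rewrite /kl_le /=; case: (ltngtP i k) => //= ik.
    by have [//|_ _ _ ->] := low i j.
  subst i; rewrite leqNgt => Hj; apply/negP => mj; move: Hj.
  case: (leqP j a) => ja; last by have [//|_ _ _ ->] := right j.
  by have [//|//|_ _ _ _ ->] := gap j.
(* For m < a the new horizontal line stops at column m, where the edge above (k, m) is erased and
   the bumped matrix gains one. For m = a no edge changes, only the bumped entry. *)
exists (fun i j => h i j || (i == k) && (m < j <= a)%N),
  (fun i j => if (i <= k)%N then j \in [seq if y == m then a else y | y <- q]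
              else v i j).
split.
- split; last first.
    have [N HN'] := HN; exists (N + k + a + (\max_(x <- q) x) + 1)%N => i j Hij.
    have [|-> ->] := HN' i j; first lia.
    split; first lia.
    case: ifP => // ik; rewrite mem_column_bump //.
    apply/negP => /orP [|/andP [jq _]]; first lia.
    by have := @leq_bigmax_seq _ q xpredT (fun x => x) j jq isT; rewrite /=;
      lia.
  move=> i j; rewrite /entries /= -!/(entries _ _ _) mem_column_bump //.
  case: (ltngtP i k) => ik /=.
  - have [-> _ -> ->] := low i j ik; have [-> _ _ _] := low i j.+1 ik.
    rewrite !xpair_eqE (gtn_eqF ik) /=.
    by case: (_ || _).
  - rewrite !orbF !xpair_eqE (ltn_eqF ik) /=.
    by rewrite -Hc.
  - subst i; rewrite !xpair_eqE eqxx /=.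
    rewrite [a == j]eq_sym [m == j]eq_sym.
    have qj := vk j; have {}Hc := Hc k j.
    case: (ltngtP j m) => jm /=.
    + rewrite (ltn_eqF (leq_trans jm ma)) ltnS leqNgt jm /=.
      by rewrite !orbF andbT -qj -Hc.
    + rewrite andbT. case: (ltngtP j a) => ja /=.
      * have [||r1 r2 r3 r4 r5] := gap j; [lia..|].
        rewrite r1 r2 r3 r4 r5 (negPf (_ : j \notin q)) //=.
          by rewrite ltnS (ltnW jm).
        by apply/negP => jq; have := Hm j jq; lia.
      * by rewrite andbF !orbF -qj -Hc.
      * subst j; have [||r1 r2 r3 r4 r5] := gap a; [lia..|].
        by rewrite r1 r2 r3 r4 r5 andbF.
    + subst j; rewrite andbF orbF ltnSn /=.
      move: Hc; rewrite vk mq; case: (ltngtP m a) => am /=.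
      * have [||-> _ _ _ _] := gap m.+1; [lia..|].
        by case: (v k.+1 m) (entries s k m) => [] [|?] //= [] <- <-.
      * by move: ma; rewrite leqNgt am.
      * subst m; have [//|-> _ _ _] := right a.+1.
        by case: (v k.+1 a) (entries s k a) => [] [|?] //= [] <- <-.
- by move=> i; rewrite Hhp andbF orbF.
- by move=> i j Hi; rewrite (Hi (k, a) (mem_head _ _)).
Qed.

Lemma pass_scan s : sorted kl_le s -> let: (p, q, t) := pass s in
  [/\ sorted ltn p, sorted ltn q, sorted kl_le t
    & scan (entries s) p q (entries t)].
Proof.
move/pass_shadows; case: (pass s) => [[p q] t] [Hp Hq Ht [h [v [H Hh Hv]]]].
by split=> //; exists h, v; split=> // j; apply: Hv.
Qed.

(** * Insertion into one column and the tensor product rule *)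

(** Prepending c lowers eps by one but not below 0: the truncated predecessor is the maximum in the
    tensor product rule. *)
Definition letter_eps (c a e : nat) : nat :=
  if a == c then e.-1 else if a == c.+1 then e.+1 else e.

Fixpoint biword_eps (c : nat) (s : seq (nat * nat)) : nat :=
  if s is x :: s' then letter_eps c x.2 (biword_eps c s') else 0%N.

Fixpoint biword_ft (c : nat) (s : seq (nat * nat)) : option (seq (nat * nat)) :=
  if s is x :: s' then
    if (x.2 == c) && (biword_eps c s' == 0%N) then Some ((x.1, c.+1) :: s')
    else omap (cons x) (biword_ft c s')
  else None.

(** The tensor product rule with a whole column as first factor: phi = 1 if it contains c but not
    c+1, eps = 1 if c+1 but not c, and both are 0 otherwise. *)
Definition column_eps (c : nat) (q : seq nat) (e : nat) : nat :=
  if c \in q then if c.+1 \in q then e else e.-1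
  else if c.+1 \in q then e.+1 else e.

Definition column_ft (c : nat) (q : seq nat) : seq nat :=
  [seq if x == c then c.+1 else x | x <- q].

Definition tensor_ft (c : nat) (st : seq nat * seq nat * seq (nat * nat)) :=
  let: (p, q, t) := st in
  if [&& c \in q, c.+1 \notin q & biword_eps c t == 0%N]
  then Some (p, column_ft c q, t)
  else omap (fun t' => (p, q, t')) (biword_ft c t).

Lemma column_insert_grows q a : (forall x, x \in q -> a < x)%N ->
  column_insert q a = (a :: q, None).
Proof.
move=> H; case: column_insertP => // m mq ma.
by have := H m mq; rewrite ltnNge ma.
Qed.

Lemma column_insert_bumps q a m : m \in q -> (m <= a)%N ->
  (forall x, x \in q -> x <= a -> x <= m)%N ->
  column_insert q a = ([seq if x == m then a else x | x <- q], Some m).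
Proof.
move=> mq ma H; case: column_insertP => [H1|m1 m1q m1a H1].
  by have := H1 m mq; rewrite ltnNge ma.
suff -> : m1 = m by [].
by apply/eqP; rewrite eqn_leq H ?H1.
Qed.

(** Both sides are decided by which of c and c+1 lie in [q] and by how [a] and [m] compare with
    them, which leaves finitely many arithmetic cases. *)
Lemma pass_step_eps c x p q t :
  let: (_, q', t') := pass_step x (p, q, t) in
  column_eps c q' (biword_eps c t')
  = letter_eps c x.2 (column_eps c q (biword_eps c t)).
Proof.
rewrite /=; move: (x.2) => a.
case: column_insertP => [H|m mq ma H] /=; rewrite /letter_eps /column_eps;
  move: (biword_eps c t) => e.
  rewrite !inE; move: (H c) (H c.+1).
  move: (c \in q) (c.+1 \in q) => X Y {H} H0 H1.
  by repeat case: ifP => ?; lia.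
rewrite !mem_column_bump //; move: (H c) (H c.+1).
have: m = c -> c \in q by move=> <-.
have: m = c.+1 -> c.+1 \in q by move=> <-.
move: (c \in q) (c.+1 \in q) => X Y {mq H} H0 H1 H2 H3.
by repeat case: ifP => ?; lia.
Qed.

Lemma column_ft_id c q : c \notin q -> column_ft c q = q.
Proof.
move=> cq; apply: map_id_in => x xq; case: eqP => // xc.
by rewrite -xc xq in cq.
Qed.

Lemma mem_column_ft c q x : c \in q ->
  (x \in column_ft c q) = (x == c.+1) || (x \in q) && (x != c).
Proof.
move=> cq; apply/mapP/idP => [[y yq ->]|/orP [/eqP ->|/andP [xq /negPf xc]]].
- by case: (eqVneq y c) => yc; rewrite ?eqxx ?yq ?yc ?orbT.
- by exists c; rewrite ?eqxx.
- by exists x => //; rewrite xc.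
Qed.

(** On the right f_i acts before the insertion of a, on the left after it. The factor that changes
    need not be the same: a letter or column entry raised before may reappear as a raised bumped
    letter. *)
Lemma pass_step_ft c k a p q t :
  tensor_ft c (pass_step (k, a) (p, q, t)) =
  if (a == c) && (column_eps c q (biword_eps c t) == 0%N)
  then Some (pass_step (k, c.+1) (p, q, t))
  else omap (pass_step (k, a)) (tensor_ft c (p, q, t)).
Proof.
rewrite /=; case: column_insertP => [H|m mq ma H] /=; rewrite /column_eps.
  have ins_t r u : (forall x, x \in u -> a < x)%N ->
      omap (pass_step (k, a)) (omap (fun t' => (p, u, t')) r)
      = omap (fun t' => (k :: p, a :: u, t')) r.
    by move=> Hu; case: r => //= t'; rewrite column_insert_grows.
  rewrite !inE; case: (eqVneq a c) => [Eac|ac] /=.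
    subst c; have aq : a \notin q by apply/negP => /H; rewrite ltnn.
    rewrite (negPf aq) (gtn_eqF (ltnSn a)) /=;
      case: (boolP (a.+1 \in q)) => sq /=.
      by rewrite ins_t.
    case: eqP => e0 /=; last by rewrite ins_t.
    rewrite column_insert_grows; last first.
      move=> x xq; rewrite ltn_neqAle H // andbT.
      by apply: contraNneq sq => ->.
    by rewrite column_ft_id.
  case: (boolP (c \in q)) => cq /=; last by rewrite ins_t.
  have ac' := H c cq; rewrite (gtn_eqF (ltn_trans ac' _)) //=.
  case: ifP => _ /=; last by rewrite ins_t.
  rewrite column_insert_grows // => x.
  rewrite mem_column_ft // => /orP [/eqP ->|/andP [/H]] //.
  exact: ltn_trans ac' _.
set q' := [seq _ | _ <- q].
have ins_t r : omap (pass_step (k, a)) (omap (fun t' => (p, q, t')) r)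
    = omap (fun t' => (p, q', t')) (omap (cons (k, m)) r).
  by case: r => //= t'; rewrite (column_insert_bumps mq).
have memq' x : (x \in q') = (x == a) || (x \in q) && (x != m).
  exact: mem_column_bump.
have Hm x : x \in q -> (x <= m)%N || (a < x)%N.
  by move=> xq; case: (leqP x a) => xa; rewrite ?orbT // H.
have [Hc Hc1] := (Hm c, Hm c.+1); rewrite !memq'.
have mc : m = c -> c \in q by move=> <-.
have mc1 : m = c.+1 -> c.+1 \in q by move=> <-.
case: (boolP ((a == c) && _)) => [/andP [/eqP Eac e0]|Hac].
  subst a; rewrite eqxx (gtn_eqF (ltnSn c)) /= {ins_t}.
  case: (eqVneq m c) => [Emc|nmc].
    subst m; rewrite mq in e0 *;
      rewrite /letter_eps eqxx (gtn_eqF (ltnSn c)) /= andbT.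
    have q'q : q' = q by apply: map_id_in => x _; case: eqP.
    (* Inserting c bumps c, while c+1 bumps c+1 if that lies in [q]: then f_i raises the bumped
       letter, otherwise the column. *)
    rewrite q'q; case: (boolP (c.+1 \in q)) e0 => sq /= e0.
      rewrite e0 /= (column_insert_bumps (m := c.+1)) //.
      by do 4?f_equal; apply/esym/map_id_in => x _; case: eqP.
    rewrite e0 (column_insert_bumps mq) // => x xq; rewrite leq_eqVlt ltnS.
    by case/orP => [/eqP Ex|/H -> //]; rewrite -Ex xq in sq.
  have ltmc : (m < c)%N by rewrite ltn_neqAle nmc.
  have cq : c \notin q by apply/negP => /H /(_ (leqnn c)); rewrite leqNgt ltmc.
  rewrite (negPf cq) in e0;
    rewrite /letter_eps (ltn_eqF ltmc) (ltn_eqF (ltn_trans ltmc _)) //.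
  case: (boolP (c.+1 \in q)) e0 => sq //= /eqP e0; rewrite e0 /=.
  rewrite (column_insert_bumps mq); last first.
  - move=> x xq; rewrite leq_eqVlt ltnS => /orP [/eqP Ex|/H -> //].
    by rewrite -Ex xq in sq.
  - exact: leq_trans ma _.
  do 3?f_equal; rewrite /column_ft -map_comp; apply/eq_in_map => x xq /=.
  case: (x =P m) => xm; rewrite ?eqxx //; case: eqP => // xc.
  by rewrite -xc xq in cq.
case: (boolP [&& c \in q, c.+1 \notin q & biword_eps c t == 0%N]) =>
  [/and3P [cq sq e0]|Hte].
  have ac : a != c by move: Hac; rewrite cq (negPf sq) (eqP e0) andbT.
  rewrite /=; case: (ltngtP a c) ac => // ac _.
    have ltmc := leq_ltn_trans ma ac.
    rewrite /letter_eps cq (negPf sq) e0 (gtn_eqF (ltn_trans ac _)) //.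
    rewrite (gtn_eqF ltmc) (ltn_eqF ltmc) (ltn_eqF (ltn_trans ltmc _)) //= e0.
    rewrite (column_insert_bumps (m := m)) //.
    - do 3?f_equal; rewrite /column_ft /q' -!map_comp;
      apply/eq_in_map => x xq /=.
      case: (x =P m) => xm.
        by rewrite xm (ltn_eqF ltmc) eqxx (ltn_eqF ac).
      case: (x =P c) => xc; last by case: eqP.
      by rewrite (gtn_eqF (ltn_trans ltmc _)).
    - by rewrite mem_column_ft // mq (ltn_eqF ltmc) orbT.
    - move=> x; rewrite mem_column_ft // => /orP [/eqP ->|/andP [/H]] //.
      by move=> ca; have := ltn_trans ac ca; rewrite ltnn.
  (* As c lies in [q] and below a, the bumped letter is at least c: it is either c itself, which is
     then raised, or beyond c+1. *)
  have cm : (c <= m)%N by apply: H => //; apply: ltnW.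
  have nm : m != c.+1 by apply: contraNneq sq => <-.
  move: cm; rewrite leq_eqVlt => /orP [/eqP Emc|cm].
    subst m; rewrite eqxx e0 andbF /=.
    rewrite (column_insert_bumps (m := c.+1)) //.
    - do 3?f_equal; rewrite /column_ft /q' -!map_comp;
      apply/eq_in_map => x xq /=.
      case: (x =P c) => xc; rewrite ?eqxx //; case: eqP => // xc1.
      by rewrite -xc1 xq in sq.
    - by rewrite mem_column_ft // eqxx.
    - move=> x; rewrite mem_column_ft // =>
      /orP [/eqP ->|/andP [xq _]] // /(H x xq).
      by move=> xc; apply: leq_trans xc _.
  have {}cm : (c.+1 < m)%N by rewrite ltn_neqAle eq_sym nm.
  have ac1 := leq_trans cm ma.
  rewrite /letter_eps cq (negPf sq) e0 (gtn_eqF cm) (gtn_eqF (ltnW cm)) (ltn_eqF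
    ac1).
  rewrite (ltn_eqF (ltnW cm)) orbT /= e0 (column_insert_bumps (m := m)) //.
  - do 3?f_equal; rewrite /column_ft /q' -!map_comp; apply/eq_in_map => x xq /=.
    case: (x =P m) => xm.
      by rewrite xm (gtn_eqF (ltnW cm)) eqxx (gtn_eqF (ltnW ac1)).
    case: (x =P c) => xc; last by case: eqP.
    by rewrite (ltn_eqF cm).
  - by rewrite mem_column_ft // mq (gtn_eqF (ltnW cm)) orbT.
  - move=> x; rewrite mem_column_ft // => /orP [/eqP -> _|/andP [/H]] //.
    exact: ltnW.
(* What remains is f_i acting on the word; neither the new column nor the bumped letter may
   intercept it. *)
rewrite ins_t.
have {}Hm x : x \in q -> (x <= a)%N -> (x <= m)%N by exact: H.
have [H0 H1] := (Hm c, Hm c.+1).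
rewrite /letter_eps; move: mc mc1 H0 H1 Hac Hte; rewrite /column_eps.
move: (biword_eps c t) (c \in q) (c.+1 \in q) => e X Y mc mc1 H0 H1 Hac Hte.
case: ifP => cond1.
  exfalso; move: cond1 Hac; case: (X) (Y) mc mc1 H0 H1 Hte => [] [];
  repeat case: ifP => ?; lia.
case: ifP => // cond2.
exfalso; move: cond2 Hac; case: (X) (Y) mc mc1 H0 H1 Hte => [] []; lia.
Qed.

(** * Operators on biwords *)

Lemma pass_eps c s : let: (_, q, t) := pass s in
  biword_eps c s = column_eps c q (biword_eps c t).
Proof.
elim: s => //= x s; case: (pass s) => [[p q] t] ->.
have := pass_step_eps c x p q t; rewrite /=.
by case: column_insertP => [_|m _ _ _] /= <-.
Qed.

Lemma pass_ft c s : omap pass (biword_ft c s) = tensor_ft c (pass s).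
Proof.
elim: s => //= -[k a] s; have := pass_eps c s.
case E : (pass s) => [[p q] t] Eeps IHs.
rewrite pass_step_ft -Eeps; case: ifP => _; first by rewrite /= E.
by rewrite -IHs; case: (biword_ft c s).
Qed.

Fixpoint biword_et (c : nat) (s : seq (nat * nat)) : option (seq (nat * nat)) :=
  if s is x :: s' then
    if (biword_eps c s' <= (x.2 == c))%N then
      if x.2 == c.+1 then Some ((x.1, c) :: s') else None
    else omap (cons x) (biword_et c s')
  else None.

Lemma biword_ft_unzip1 c s s1 : biword_ft c s = Some s1 -> unzip1 s1 = unzip1 s.
Proof.
elim: s s1 => //= x s IHs s1; case: ifP => _; first by case=> <-.
by case E : (biword_ft c s) => [s2|] //= [<-] /=; rewrite (IHs _ E).
Qed.

Lemma biword_et_unzip1 c s s1 : biword_et c s = Some s1 -> unzip1 s1 = unzip1 s.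
Proof.
elim: s s1 => //= x s IHs s1; case: ifP => _.
  by case: ifP => // _ [<-].
by case E : (biword_et c s) => [s2|] //= [<-] /=; rewrite (IHs _ E).
Qed.

(** The order could break only if the preceding pair had the same first coordinate and the letter c,
    but then f_i would have acted on that earlier c. *)
Lemma biword_ft_sorted c s s1 :
  sorted kl_le s -> biword_ft c s = Some s1 -> sorted kl_le s1.
Proof.
elim: s s1 => //= -[k a] s IHs s1 Hs; case: ifP => [/andP [/= /eqP Ea _]|Hact].
  case=> <- /=; subst a; case: s Hs {IHs} => //= -[k' b] s /andP [H ->].
  by rewrite andbT; move: H;
    rewrite /kl_le /= => /orP [->|/andP [-> /leqW ->]] //; rewrite orbT.
case E : (biword_ft c s) => [s2|] //= [<-] /=.
have := IHs _ (path_sorted Hs) E; case: s Hs Hact E {IHs} => //= -[k' b] s.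
case/andP=> H _ Hact; case: ifP => [/andP [/= /eqP Eb /eqP e0] [<-]|_].
  move=> /= ->; rewrite andbT; subst b; move: H Hact.
  rewrite /kl_le /letter_eps /= eqxx e0 andbT => /orP [->|/andP [->]] //.
  by rewrite leq_eqVlt eq_sym => /orP [->|->]; rewrite ?orbT.
by case: (biword_ft c s) => //= s3 [<-] /= ->; rewrite H.
Qed.

(** The order could break only against a following c+1 with the same first coordinate, but this
    makes eps of the tail positive, so e_i acts further right. *)
Lemma biword_et_sorted c s s1 :
  sorted kl_le s -> biword_et c s = Some s1 -> sorted kl_le s1.
Proof.
elim: s s1 => //= -[k a] s IHs s1 Hs; case: ifP => Hact.
  case: ifP => //= /eqP Ea [<-]; subst a; move: Hact;
    rewrite (gtn_eqF (ltnSn c)) leqn0.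
  case: s Hs {IHs} => //= -[k' b] s /andP [H ->];
    rewrite andbT /letter_eps /= => e0.
  move: H; rewrite /kl_le /= => /orP [->|/andP [->]] //.
  rewrite leq_eqVlt ltnS => /orP [/eqP Eb|->]; last by rewrite orbT.
  by rewrite Eb eqxx (gtn_eqF (ltnSn c)) in e0.
case E : (biword_et c s) => [s2|] //= [<-] /=.
have := IHs _ (path_sorted Hs) E; case: s Hs Hact E {IHs} => //= -[k' b] s.
case/andP=> H _ Hact; case: ifP => [_|_].
  case: ifP => //= /eqP Eb [<-] /= ->; rewrite andbT; subst b; move: H.
  by rewrite /kl_le /= => /orP [->|/andP [-> /ltnW ->]] //; rewrite orbT.
by case: (biword_et c s) => //= s3 [<-] /= ->; rewrite H.
Qed.

(** In the coding by nat both alphabets look alike at one index: c goes to c+1, with i = c+1 for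
    positive letters and i = -(c+1) for dual ones. Words are thus treated once. *)
Record letter_crystal (wt : nat -> weight) (eps phi : int -> nat -> zbar)
    (et ft : int -> nat -> option nat) (i : int) (c : nat) : Prop :=
  LetterCrystal {
  letter_epsE : forall m, eps i m = Some (b2z (m == c.+1));
  letter_phiE : forall m, phi i m = Some (b2z (m == c));
  letter_etE : forall m, et i m = if m == c.+1 then Some m.-1 else None;
  letter_ftE : forall m, ft i m = if m == c then Some m.+1 else None;
  letter_wtS : wt c.+1 = wt c - alpha i;
  letter_pairing : forall m, pairing (wt m) i = b2z (m == c) - b2z (m == c.+1)
    }.

Section LetterCrystal.
Context (w : nat -> weight) (e p : int -> nat -> zbar)
  (E F : int -> nat -> option nat) (i : int) (c : nat)
  (H : letter_crystal w e p E F i c).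
Let B := Precrystal w e p E F.

Lemma letter_crystal_at : crystal_at B i.
Proof.
split=> /=.
- move=> m; rewrite (letter_epsE H) (letter_phiE H) (letter_pairing H) /=.
  by rewrite addrCA subrr addr0.
- move=> m m'; rewrite (letter_etE H); case: eqP => // -> [<-] /=.
  rewrite !(letter_epsE H) !(letter_phiE H) /= !eqxx (letter_wtS H) subrK.
  by rewrite (ltn_eqF (ltnSn c)) (gtn_eqF (ltnSn c)).
- move=> m m'; rewrite (letter_ftE H); case: eqP => // -> [<-] /=.
  rewrite !(letter_epsE H) !(letter_phiE H) /= !eqxx (letter_wtS H).
  by rewrite (ltn_eqF (ltnSn c)) (gtn_eqF (ltnSn c)).
- move=> m m'; rewrite (letter_ftE H) (letter_etE H); split.
    by case: eqP => // -> [<-]; rewrite eqxx.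
  by case: eqP => // -> [<-]; rewrite eqxx.
- by move=> m; rewrite (letter_phiE H).
Qed.

Lemma word_epsE s : @word_eps B i (unzip2 s) = Some (biword_eps c s)%:Z.
Proof.
elim: s => //= x s ->; rewrite (letter_epsE H) (letter_pairing H) /= /zmax /=.
rewrite /letter_eps /b2z; move: (x.2) (biword_eps c s) => a n.
case: (eqVneq a c) => [->|ac]; last case: (eqVneq a c.+1) => ac1.
- by rewrite (ltn_eqF (ltnSn c)) /=; case Hn: (_ <= _)%R; congr Some; lia.
- by case Hn: (_ <= _)%R; congr Some; lia.
- by case Hn: (_ <= _)%R; congr Some; lia.
Qed.

Lemma word_ftE s : @word_ft B i (unzip2 s) = omap (@unzip2 nat nat) (biword_ft c
  s).
Proof.
elim: s => //= x s ->; rewrite word_epsE (letter_ftE H) (letter_phiE H) /=.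
case: (eqVneq x.2 c) => [xc|xc] /=; last by case: (biword_ft c s).
case: (biword_eps c s) => [|n] /=; first by rewrite xc.
by case: (biword_ft c s).
Qed.

Lemma word_etE s : @word_et B i (unzip2 s) = omap (@unzip2 nat nat) (biword_et c
  s).
Proof.
elim: s => //= x s ->; rewrite word_epsE (letter_etE H) (letter_phiE H) /= /b2z.
rewrite lez_nat; case: ifP => _; last by case: (biword_et c s).
by case: eqP => //= ->.
Qed.
End LetterCrystal.

Lemma Bpos_letter (c : nat) : letter_crystal (@wt Bpos) (@eps Bpos) (@phi Bpos)
  (@et Bpos) (@ft Bpos) c.+1%:Z c.
Proof.
have Hc m : (m.+1%:Z == c.+1%:Z + 1) = (m == c.+1) by apply/eqP/eqP; lia.
have Hp : lp c.+1 = zpos c by apply: val_inj.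
have Hq : lq c.+1 = zpos c.+1 by apply: val_inj; rewrite /=; lia.
split=> [m|m|m|m||m] //=; rewrite ?Hc //.
  by rewrite /alpha Hp Hq subKr.
rewrite pairing_epsilon Hp Hq -!val_eqE /=; congr (_ - _).
Qed.

Lemma Bneg_dual_letter (c : nat) : letter_crystal (@wt Bneg_dual) (@eps
  Bneg_dual)
  (@phi Bneg_dual) (@et Bneg_dual) (@ft Bneg_dual) (Negz c) c.
Proof.
have Hc m : (- m.+1%:Z == Negz c - 1) = (m == c.+1) by apply/eqP/eqP; lia.
have Hc1 m : (- m.+1%:Z == Negz c) = (m == c) by apply/eqP/eqP; lia.
have Hp : lp (Negz c) = zneg c.+1 by apply: val_inj; rewrite /=; lia.
have Hq : lq (Negz c) = zneg c by apply: val_inj; rewrite /=; lia.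
split=> [m|m|m|m||m]; rewrite /= ?Hc ?Hc1 //.
  by rewrite /alpha Hp Hq opprB addrA addNr add0r.
rewrite pairingN pairing_epsilon Hp Hq -!val_eqE /= opprB !eqr_opp.
by congr (_ - _).
Qed.

(** * The crystal M *)

Definition swap (x : nat * nat) : nat * nat := (x.2, x.1).

Lemma swapK : involutive swap. Proof. by case. Qed.

Definition tr_mset (A : matM) : matM :=
  seq_mset [seq swap x | x <- enum_mset A].

Lemma tr_msetE A i j : tr_mset A (i, j) = A (j, i).
Proof.
rewrite mset_seqE count_map -[RHS]count_mem_mset; apply: eq_count => -[a b] /=.
by rewrite /swap !xpair_eqE /= andbC.
Qed.

Lemma tr_msetK : involutive tr_mset.
Proof. by move=> A; apply/msetP => -[i j]; rewrite !tr_msetE. Qed.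

Lemma entries_seq_mset s i j : seq_mset s (i, j) = entries s i j.
Proof. exact: mset_seqE. Qed.

Lemma biword_kl_sorted A : sorted kl_le (biword_kl A).
Proof. exact: sort_sorted kl_le_total _. Qed.

Lemma biword_klK A : seq_mset (biword_kl A) = A.
Proof.
rewrite -[RHS]seq_mset_id; apply/eq_seq_msetP; rewrite perm_sort //.
Qed.

Lemma seq_msetK s : sorted kl_le s -> biword_kl (seq_mset s) = s.
Proof.
move=> Hs; apply: (sorted_eq kl_le_trans kl_le_anti) => //.
  exact: biword_kl_sorted.
by rewrite perm_sort; apply: perm_eq_seq_mset.
Qed.

Lemma entries_biword_kl A i j : entries (biword_kl A) i j = A (i, j).
Proof. by rewrite -entries_seq_mset biword_klK. Qed.

(** The two sorting conventions differ by exchanging the coordinates, which turns i < 0 into i > 0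
    for the transposed matrix. *)
Lemma biword_ijE A : biword_ij A = [seq swap x | x <- biword_kl (tr_mset A)].
Proof.
have E : perm_eq (enum_mset (tr_mset A)) [seq swap x | x <- enum_mset A].
  exact: perm_eq_seq_mset.
rewrite /biword_kl ((perm_sortP kl_le_total kl_le_trans kl_le_anti _ _) E).
rewrite sort_map -map_comp (eq_map (g := id)) ?map_id //.
by move=> x /=; rewrite swapK.
Qed.

Lemma word_iE A : word_i A = unzip2 (biword_kl (tr_mset A)).
Proof. by rewrite /word_i biword_ijE /unzip1 -map_comp. Qed.

Lemma word_jE A : word_j A = unzip1 (biword_kl (tr_mset A)).
Proof. by rewrite /word_j biword_ijE /unzip2 -map_comp. Qed.

Lemma M_wtE A s : perm_eq (enum_mset A) s ->
  M_wt A = @word_wt Bneg_dual (unzip1 s) + @word_wt Bpos (unzip2 s).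
Proof.
move=> As; rewrite /word_wt /unzip1 /unzip2 !big_map -big_split /=.
rewrite -(perm_big _ As) /= /M_wt.
rewrite -(perm_big _ (perm_undup_mset A)) /= -[RHS]big_undup_iterop_count.
by apply: eq_bigr => x _; rewrite count_mem_mset.

Qed.

Lemma M_wt_kl A : M_wt A = @word_wt Bneg_dual (unzip1 (biword_kl A))
  + @word_wt Bpos (unzip2 (biword_kl A)).
Proof. by apply: M_wtE; rewrite perm_sym perm_sort. Qed.

Lemma M_wt_ij A : M_wt A = @word_wt Bpos (unzip1 (biword_kl (tr_mset A)))
  + @word_wt Bneg_dual (unzip2 (biword_kl (tr_mset A))).
Proof.
rewrite addrC -word_iE -word_jE; apply: M_wtE.
by rewrite perm_sym perm_sort.
Qed.

Lemma M_eps_pos c A : M_eps c.+1%:Z A = Some (biword_eps c (biword_kl A))%:Z.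
Proof. exact: (word_epsE (Bpos_letter c)). Qed.

Lemma M_eps_neg c A : M_eps (Negz c) A = M_eps c.+1%:Z (tr_mset A).
Proof.
by rewrite M_eps_pos /M_eps /= word_iE; apply: (word_epsE (Bneg_dual_letter c)).
Qed.

Lemma zip_unzip1 (s s1 : seq (nat * nat)) :
  unzip1 s1 = unzip1 s -> zip (unzip1 s) (unzip2 s1) = s1.
Proof. by move=> <-; apply: zip_unzip. Qed.

Lemma M_ft_pos c A : M_ft c.+1%:Z A = omap (@seq_mset _) (biword_ft c (biword_kl
  A)).
Proof.
rewrite /M_ft /= /word_l (word_ftE (Bpos_letter c)) /word_k.
case E: (biword_ft c _) => [s1|] //=.
by rewrite zip_unzip1 // (biword_ft_unzip1 E).
Qed.

Lemma M_et_pos c A : M_et c.+1%:Z A = omap (@seq_mset _) (biword_et c (biword_kl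
  A)).
Proof.
rewrite /M_et /= /word_l (word_etE (Bpos_letter c)) /word_k.
case E: (biword_et c _) => [s1|] //=.
by rewrite zip_unzip1 // (biword_et_unzip1 E).
Qed.

Lemma seq_mset_swap s :
  seq_mset (zip (unzip2 s) (unzip1 s)) = tr_mset (seq_mset s).
Proof.
have -> : zip (unzip2 s) (unzip1 s) = [seq swap x | x <- s].
  by elim: s => //= x s ->.
by apply/eq_seq_msetP; rewrite perm_map // perm_sym perm_eq_seq_mset.
Qed.

Lemma M_ft_neg c A : M_ft (Negz c) A = omap tr_mset (M_ft c.+1%:Z (tr_mset A)).
Proof.
rewrite M_ft_pos /M_ft /= word_iE (word_ftE (Bneg_dual_letter c)) word_jE.
case E: (biword_ft c _) => [s1|] //=.
by rewrite -(biword_ft_unzip1 E) seq_mset_swap.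
Qed.

Lemma M_et_neg c A : M_et (Negz c) A = omap tr_mset (M_et c.+1%:Z (tr_mset A)).
Proof.
rewrite M_et_pos /M_et /= word_iE (word_etE (Bneg_dual_letter c)) word_jE.
case E: (biword_et c _) => [s1|] //=.
by rewrite -(biword_et_unzip1 E) seq_mset_swap.
Qed.

(** Serves i > 0 and i < 0 alike: [arr] arranges the pairs so that the second coordinates are acted
    on, and [R] is the weight of the fixed coordinates, invisible to h_i. *)
Lemma arranged_crystal_at (w : nat -> weight) (e p : int -> nat -> zbar)
    (E F : int -> nat -> option nat) (i : int) (c : nat)
    (B := Precrystal w e p E F)
    (arr : matM -> seq (nat * nat)) (unarr : seq (nat * nat) -> matM)
    (R : seq nat -> weight) :
  letter_crystal w e p E F i c ->
  cancel arr unarr -> (forall A, sorted kl_le (arr A)) ->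
  (forall s, sorted kl_le s -> arr (unarr s) = s) ->
  (forall A, M_eps i A = Some (biword_eps c (arr A))%:Z) ->
  (forall A, M_phi i A = @word_phi B i (unzip2 (arr A))) ->
  (forall A, M_et i A = omap unarr (biword_et c (arr A))) ->
  (forall A, M_ft i A = omap unarr (biword_ft c (arr A))) ->
  (forall A, M_wt A = R (unzip1 (arr A)) + @word_wt B (unzip2 (arr A))) ->
  (forall s, pairing (R s) i = 0) ->
  crystal_at Mcal i.
Proof.
move=> H arrK arrS unarrK Heps Hphi Het Hft Hwt HR.
have HB : crystal_at (words B) i by apply/words_crystal_at/letter_crystal_at/H.
have Heps' A : M_eps i A = eps i (unzip2 (arr A) : words B).
  by rewrite Heps /= (word_epsE H).
have Eet A A' : M_et i A = Some A' -> unzip1 (arr A') = unzip1 (arr A) /\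
    et i (unzip2 (arr A) : words B) = Some (unzip2 (arr A')).
  rewrite Het /= (word_etE H); case Es: (biword_et c _) => [s|] //= [<-].
  by rewrite unarrK ?(biword_et_unzip1 Es) // (biword_et_sorted _ Es).
have Eft A A' : M_ft i A = Some A' -> unzip1 (arr A') = unzip1 (arr A) /\
    ft i (unzip2 (arr A) : words B) = Some (unzip2 (arr A')).
  rewrite Hft /= (word_ftE H); case Es: (biword_ft c _) => [s|] //= [<-].
  by rewrite unarrK ?(biword_ft_unzip1 Es) // (biword_ft_sorted _ Es).
have zipE (s : seq (nat * nat)) : zip (unzip1 s) (unzip2 s) = s by apply:
  zip_unzip.
split=> /=.
- move=> A; rewrite Hphi Heps' Hwt pairingD HR add0r; exact: (at_phi HB).
- move=> A A' /Eet [E1 /(at_et HB) /= [H1 H2 H3]].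
  by rewrite !Heps' !Hphi !Hwt E1 /= H1 H2 H3 addrA.
- move=> A A' /Eft [E1 /(at_ft HB) /= [H1 H2 H3]].
  by rewrite !Heps' !Hphi !Hwt E1 /= H1 H2 H3 addrA.
- move=> A A'; split.
    move=> /Eft [E1 /(at_etft HB)]; rewrite Het /= (word_etE H).
    case Es: (biword_et c _) => [s|] //= [E2]; congr Some.
    by rewrite -[s]zipE (biword_et_unzip1 Es) E2 E1 zipE arrK.
  move=> /Eet [E1 /(at_etft HB)]; rewrite Hft /= (word_ftE H).
  case Es: (biword_ft c _) => [s|] //= [E2]; congr Some.
  by rewrite -[s]zipE (biword_ft_unzip1 Es) E2 E1 zipE arrK.
- by move=> A; rewrite Hphi (words_phi _ (letter_crystal_at H)) (word_epsE H).
Qed.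

Lemma mset_addE (A : matM) (x y : nat * nat) :
  (A `+` [mset x])%mset y = (A y + (y == x))%N.
Proof. by rewrite msetDC mset1DE addnC. Qed.

Lemma M_wtD (A : matM) (x : nat * nat) : M_wt (A `+` [mset x])%mset =
  M_wt A + (- epsilon (zneg x.1) + epsilon (zpos x.2)).
Proof.
rewrite (M_wtE (perm_refl (enum_mset A))) (@M_wtE _ (x :: enum_mset A)) /=.
  by rewrite /word_wt !big_cons /= addrACA [RHS]addrC.
apply/eq_seq_msetP; rewrite seq_mset_id; apply/msetP => y.
by rewrite mset_addE mset_seqE /= count_mem_mset addnC eq_sym.
Qed.

Lemma Mcal_crystal_at0 : crystal_at Mcal 0.
Proof.
have E0 : alpha 0 = - (- epsilon (zneg 0) + epsilon (zpos 0)).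
  by rewrite opprD opprK /alpha; congr (epsilon _ - epsilon _); apply: val_inj.
have wtD A : M_wt (A `+` [mset (0, 0)%N])%mset = M_wt A - alpha 0.
  by rewrite M_wtD E0 opprK.
have etft A A' : M_ft 0 A = Some A' <-> M_et 0 A' = Some A.
  rewrite /M_ft /M_et /=; split=> [[<-]|].
    rewrite mset_addE eqxx addn1 /=; congr Some; apply/msetP => y.
    by rewrite msetB1E mset_addE addnK.
  case: eqP => //= /eqP H [<-]; congr Some; rewrite msetDC.
  by rewrite msetB1K // in_mset lt0n.
have ftE A A' : M_ft 0 A = Some A' ->
    [/\ M_eps 0 A' = zadd (M_eps 0 A) 1, M_phi 0 A' = zadd (M_phi 0 A) (- 1)
      & M_wt A' = M_wt A - alpha 0].
  case=> <-; rewrite /M_phi /M_eps /= wtD !mset_addE eqxx.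
  by rewrite pairingD pairingN pairing_alpha /=; split=> //; congr Some; lia.
split=> //= A A' /etft /ftE.
rewrite /M_phi /M_eps /= => -[[H1] [H2] H3].
by split; [congr Some; lia | congr Some; lia | rewrite H3 subrK].
Qed.

Lemma Mcal_crystal : is_crystal Mcal.
Proof.
have Rneg (i : int) s : 0 < i -> pairing (@word_wt Bneg_dual s) i = 0.
  move=> i0; elim: s => [|m s IHs]; first by rewrite /word_wt big_nil pairing0.
  rewrite /word_wt big_cons pairingD -/(word_wt s) IHs addr0.
  rewrite pairingN pairing_epsilon -!val_eqE /=.
  by rewrite i0 (ltW i0); case: eqP => [|_]; case: eqP => [|_] //; lia.
have Rpos (i : int) s : i < 0 -> pairing (@word_wt Bpos s) i = 0.
  move=> i0; elim: s => [|m s IHs]; first by rewrite /word_wt big_nil pairing0.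
  rewrite /word_wt big_cons pairingD -/(word_wt s) IHs addr0.
  rewrite pairing_epsilon -!val_eqE /= ltNge (ltW i0) leNgt i0 /=.
  by case: eqP => [|_]; case: eqP => [|_] //; lia.
apply/crystal_atP => -[[|c]|c].
- exact: Mcal_crystal_at0.
- apply: (arranged_crystal_at (Bpos_letter c) biword_klK biword_kl_sorted
    seq_msetK (M_eps_pos c) _ (M_et_pos c) (M_ft_pos c) M_wt_kl) => // s.
  exact: Rneg.
- apply: (arranged_crystal_at (arr := fun A => biword_kl (tr_mset A))
    (unarr := fun s => tr_mset (seq_mset s)) (Bneg_dual_letter c) _ _ _ _ _ _ _
    M_wt_ij).
  + by move=> A; rewrite biword_klK tr_msetK.
  + by move=> A; apply: biword_kl_sorted.
  + by move=> s Hs; rewrite tr_msetK seq_msetK.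
  + by move=> A; rewrite M_eps_neg M_eps_pos.
  + by move=> A; rewrite -word_iE.
  + by move=> A; rewrite M_et_neg M_et_pos; case: biword_et.
  + by move=> A; rewrite M_ft_neg M_ft_pos; case: biword_ft.
  + by move=> s; apply: Rpos.
Qed.

(** * Peeling off the first columns *)

(** Left and right refer to the two tableaux of [kappa A]: these are the rightmost columns of P(A)
    and Q(A), see [kappaE]. *)
Definition left_column (A : matM) : seq nat := (pass (biword_kl A)).1.1.
Definition right_column (A : matM) : seq nat := (pass (biword_kl A)).1.2.
Definition bumped (A : matM) : matM := seq_mset (pass (biword_kl A)).2.

Lemma pass_biword_kl A :
  pass (biword_kl A) = (left_column A, right_column A, biword_kl (bumped A)).
Proof.
have := pass_scan (biword_kl_sorted A);
  rewrite /left_column /right_column /bumped.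
by case: (pass _) => [[p q] t] [_ _ Ht _]; rewrite seq_msetK.
Qed.

Lemma columns_scan A : [/\ sorted ltn (left_column A), sorted ltn (right_column
  A)
  & scan (fun i j => A (i, j)) (left_column A) (right_column A)
         (fun i j => bumped A (i, j))].
Proof.
have := pass_scan (biword_kl_sorted A); rewrite pass_biword_kl => -[Hp Hq _ H].
have E B : entries (biword_kl B) = fun i j => B (i, j).
  by apply/funext => i; apply/funext => j; rewrite entries_biword_kl.
by rewrite !E in H.
Qed.

(** Shadow diagrams are unique and a strictly increasing sequence is determined by its elements, so
    a scan found by any means computes the columns. *)
Lemma scan_columns (A : matM) p q (B : matM) : sorted ltn p -> sorted ltn q ->
  scan (fun i j => A (i, j)) p q (fun i j => B (i, j)) ->
  [/\ left_column A = p, right_column A = q & bumped A = B].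
Proof.
move=> Hp Hq H; have [Hp' Hq' H'] := columns_scan A.
have [Ep Eq EB] := scan_fun H' H.
split; try exact: irr_sorted_eq ltn_trans ltnn _ _ _ _ _.
by apply/msetP => -[i j]; apply: EB.
Qed.

(* The local rule is symmetric, so that visiting the cells row by row or column
   by column gives the same shadow lines. *)
Lemma columns_tr A : [/\ left_column (tr_mset A) = right_column A,
  right_column (tr_mset A) = left_column A
  & bumped (tr_mset A) = tr_mset (bumped A)].
Proof.
have [Hp Hq /scan_tr H] := columns_scan A; apply: scan_columns => //.
have E B : (fun i j => tr_mset B (i, j)) = fun i j => B (j, i).
  by apply/funext => i; apply/funext => j; rewrite tr_msetE.
by rewrite !E.
Qed.

Lemma biword_kl0 : biword_kl mset0 = [::].
Proof. by rewrite /biword_kl enum_mset0. Qed.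

Lemma biword_kl_eq_nil A : (biword_kl A == [::]) = (A == mset0).
Proof.
apply/eqP/eqP => [E|->]; last exact: biword_kl0.
rewrite -[A]biword_klK E; apply/msetP => x.
by rewrite mset_seqE mset0E.
Qed.

Lemma tr_mset_eq0 A : (tr_mset A == mset0) = (A == mset0).
Proof.
have tr0 : tr_mset mset0 = mset0.
  by apply/msetP => -[i j]; rewrite tr_msetE !mset0E.
by apply/eqP/eqP => [E|->//]; rewrite -[A]tr_msetK E.
Qed.

Lemma right_column_eq_nil A : (right_column A == [::]) = (A == mset0).
Proof.
by have := pass_eq_nil (biword_kl A); rewrite pass_biword_kl biword_kl_eq_nil.
Qed.

Lemma left_column_eq_nil A : (left_column A == [::]) = (A == mset0).
Proof.
by have [_ <- _] := columns_tr A; rewrite right_column_eq_nil tr_mset_eq0.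
Qed.

(** P(A) is the Q-tableau of the transposed matrix, so [columns_tr] identifies its first column with
    the recording column of A. *)
Lemma kappaE A : kappa A =
  if A == mset0 then ([::], [::])
  else (left_column A :: (kappa (bumped A)).1, right_column A :: (kappa (bumped
    A)).2).
Proof.
pose f B := Ptab (rev (unzip2 (biword_kl B))).
have K B : kappa B = (f (tr_mset B), f B) by rewrite /kappa word_iE.
have H B : f B = if B == mset0 then [::] else right_column B :: f (bumped B).
  rewrite /f Ptab_pass pass_biword_kl -biword_kl_eq_nil.
  by case: (biword_kl B).
rewrite !K; clearbody f; rewrite (H A) (H (tr_mset A)) tr_mset_eq0.
by case: eqP => // _; have [_ -> ->] := columns_tr A.
Qed.

Lemma size_pass s : let: (_, q, t) := pass s in (size q + size t = size s)%N.
Proof.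
elim: s => //= x s; case: (pass s) => [[p q] t] /= <-.
by case: column_insertP => [_|m _ _ _] /=; rewrite ?size_map ?addnS.
Qed.

Lemma kappa_inj : injective kappa.
Proof.
move=> A B; move: {2}(size (biword_kl A)) (leqnn (size (biword_kl A))) => n.
elim: n A B => [|n IHn] A B HA.
  have A0 : A = mset0.
    by apply/eqP; rewrite -biword_kl_eq_nil; case: (biword_kl A) HA.
  by rewrite A0 (kappaE mset0) (kappaE B) eqxx; case: eqP.
rewrite (kappaE A) (kappaE B); case: eqP => [->|A0]; case: eqP => [->|B0] //.
case EA: (kappa (bumped A)) => [P Q]; case EB: (kappa (bumped B)) => [P' Q'] /=.
case=> Ep EP Eq EQ; have {EA EB EP EQ}EB : bumped A = bumped B.
  apply: IHn; last by rewrite EA EB EP EQ.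
  have := size_pass (biword_kl A); have := right_column_eq_nil A.
  rewrite pass_biword_kl; case: (right_column A) => [|x q] /=.
    by move/eqP: A0 => /negPf ->.
  by move=> _ Es; rewrite -ltnS (leq_trans _ HA) // -Es addSn ltnS leq_addl.
have [_ _ HsA] := columns_scan A; have [_ _ HsB] := columns_scan B.
apply/msetP => -[i j]; apply: (scan_inj HsA HsB) => [x|x|i' j'].
- by rewrite Ep.
- by rewrite Eq.
- by rewrite EB.
Qed.

(** Empty columns are allowed, so that the list can have one entry for each of the n factors of a
    tuple. *)
Fixpoint layered (A : matM) (cs : seq (seq nat * seq nat)) : Prop :=
  if cs is c :: cs'
  then [/\ left_column A = c.1, right_column A = c.2 & layered (bumped A) cs']
  else A = mset0.

Lemma columns0 : [/\ left_column mset0 = [::], right_column mset0 = [::]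
  & bumped mset0 = mset0].
Proof.
rewrite /left_column /right_column /bumped biword_kl0; split=> //.
by apply/msetP => x; rewrite mset_seqE mset0E.
Qed.

(** One empty column forces the matrix to be zero and all later columns to be empty, so dropping
    empty columns only cuts off the end. *)
Lemma layered_kappa A cs : layered A cs ->
  kappa A = (nonempty_columns (unzip1 cs), nonempty_columns (unzip2 cs)).
Proof.
elim: cs A => [|[p q] cs IHcs] A /=; first by move=> ->; rewrite kappaE eqxx.
case=> Ep Eq /IHcs E; rewrite /nonempty_columns /= -!/(nonempty_columns _).
rewrite -Ep -Eq left_column_eq_nil right_column_eq_nil (kappaE A) E.
case: eqP E => [->|_ _] //=; have [_ _ ->] := columns0.
by rewrite kappaE eqxx => -[<- <-].
Qed.

Lemma kappa_invK A : kappa_inv (kappa A) = A.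
Proof.
rewrite /kappa_inv; case: xgetP => [B _ /= /kappa_inj //|H].
by case: (H A).
Qed.

(* Single columns: the pair (p, q) of finite sets stands for the element of
   B(Lambda_0) that lacks the negative letters -(m+1) with m in p, and has the
   positive letters m+1 with m in q. *)
Definition pair_eps (i : int) (c : seq nat * seq nat) (e : nat) : nat :=
  match i with
  | Posz 0 => if 0%N \in c.1 then if 0%N \in c.2 then e.+1 else e
              else if 0%N \in c.2 then e else e.-1
  | Posz k.+1 => column_eps k c.2 e
  | Negz k => column_eps k c.1 e
  end.

Definition pair_phi (i : int) (c : seq nat * seq nat) : bool :=
  match i with
  | Posz 0 => (0%N \notin c.1) && (0%N \notin c.2)
  | Posz k.+1 => (k \in c.2) && (k.+1 \notin c.2)
  | Negz k => (k \in c.1) && (k.+1 \notin c.1)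
  end.

Definition pair_ft (i : int) (c : seq nat * seq nat) : seq nat * seq nat :=
  match i with
  | Posz 0 => (0%N :: c.1, 0%N :: c.2)
  | Posz k.+1 => (c.1, column_ft k c.2)
  | Negz k => (column_ft k c.1, c.2)
  end.

Definition matM_eps (i : int) (A : matM) : nat :=
  match i with
  | Posz 0 => A (0, 0)%N
  | Posz k.+1 => biword_eps k (biword_kl A)
  | Negz k => biword_eps k (biword_kl (tr_mset A))
  end.

Lemma M_epsE i A : M_eps i A = Some (matM_eps i A)%:Z.
Proof.
by case: i => [[|k]|k] //; rewrite ?M_eps_neg M_eps_pos.
Qed.

(** Adding one at (0, 0) affects only that cell, the last one. If nothing leaves it and its bumped
    entry is 0, it was empty and now emits two lines; otherwise the bumped entry grows. *)
Lemma scan_corner (A : matM) p q (B : matM) :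
  scan (fun i j => A (i, j)) p q (fun i j => B (i, j)) ->
  matM_eps 0 A = pair_eps 0 (p, q) (matM_eps 0 B) /\
  if pair_phi 0 (p, q) && (matM_eps 0 B == 0%N)
  then scan (fun i j => (A `+` [mset (0, 0)%N])%mset (i, j)) (0%N :: p) (0%N ::
    q)
            (fun i j => B (i, j))
  else scan (fun i j => (A `+` [mset (0, 0)%N])%mset (i, j)) p q
            (fun i j => (B `+` [mset (0, 0)%N])%mset (i, j)).
Proof.
move=> [h [v [[Hc [N HN]] Hp Hq]]]; have H00 := Hc 0%N 0%N.
split=> /=; rewrite -Hp -Hq.
  by move: H00; case: (h 0%N 1%N) (v 1%N 0%N) (A _) => [] [] [|a] /= [<- <- <-].
case: ifP => Hb.
  exists (fun i j => ((i, j) == (0, 0)%N) || h i j),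
    (fun i j => ((i, j) == (0, 0)%N) || v i j).
  split=> [|[|i]|[|j]]; rewrite ?inE ?Hp ?Hq //=.
  split; last first.
    exists N.+1 => i j Hij; have [|-> ->] := HN i j; first exact: ltnW.
    by rewrite orbF; case: eqP Hij => // -[-> ->].
  move=> i j; rewrite !xpair_eqE mset_addE xpair_eqE /= andbF /=.
  case: (eqVneq i 0%N) => [->|i0]; last by rewrite addn0 Hc.
  case: (eqVneq j 0%N) => [->|j0]; last by rewrite addn0 Hc.
  move: H00 Hb.
  by case: (h 0%N 1%N) (v 1%N 0%N) (A _) => [] [] [|a] /= [<- <- <-].
exists h, v; split=> //; split; last by exists N.
move=> i j; rewrite !mset_addE xpair_eqE /=.
case: (eqVneq i 0%N) => [->|i0]; last by rewrite !addn0 Hc.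
case: (eqVneq j 0%N) => [->|j0]; last by rewrite !addn0 Hc.
move: H00 Hb; rewrite !addn1.
by case: (h 0%N 1%N) (v 1%N 0%N) (A _) => [] [] [|a] /= [<- <- <-].
Qed.

(** * One layer as a tensor factor *)

Lemma layer_eps i A : matM_eps i A =
  pair_eps i (left_column A, right_column A) (matM_eps i (bumped A)).
Proof.
case: i => [[|k]|k] /=.
- by have [_ _ /scan_corner []] := columns_scan A.
- by have := pass_eps k (biword_kl A); rewrite pass_biword_kl.
- have := pass_eps k (biword_kl (tr_mset A)); rewrite pass_biword_kl.
  by have [_ -> ->] := columns_tr A.
Qed.

Lemma layer_ft_pos (k : nat) A :
  let c := (left_column A, right_column A) in
  if pair_phi k.+1 c && (matM_eps k.+1 (bumped A) == 0%N) then
    exists A1, [/\ M_ft k.+1 A = Some A1,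
      (left_column A1, right_column A1) = pair_ft k.+1 c & bumped A1 = bumped A]
  else forall D, M_ft k.+1 (bumped A) = Some D ->
    exists A1, [/\ M_ft k.+1 A = Some A1,
      (left_column A1, right_column A1) = c & bumped A1 = D].
Proof.
move=> c; have := pass_ft k (biword_kl A); rewrite pass_biword_kl /=.
rewrite !M_ft_pos.
have Hs s p q t : biword_ft k (biword_kl A) = Some s -> pass s = (p, q, t) ->
    [/\ left_column (seq_mset s) = p, right_column (seq_mset s) = q
      & bumped (seq_mset s) = seq_mset t].
  move=> Es Eps; have Ss := biword_ft_sorted (biword_kl_sorted A) Es.
  by rewrite /left_column /right_column /bumped seq_msetK // Eps.
rewrite -andbA; case: ifP => _.
  case Es: (biword_ft k (biword_kl A)) =>
    [s|] //= [] /(Hs _ _ _ _ Es) [E1 E2 E3].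
  by exists (seq_mset s); rewrite E1 E2 E3 biword_klK.
move=> H D; case Et: (biword_ft k (biword_kl (bumped A))) H => [t|] //=.
case Es: (biword_ft k (biword_kl A)) =>
  [s|] //= [] /(Hs _ _ _ _ Es) [E1 E2 E3] [<-].
by exists (seq_mset s); rewrite E1 E2 E3.
Qed.

Lemma sorted_cons0 (p : seq nat) :
  0%N \notin p -> sorted ltn p -> sorted ltn (0%N :: p).
Proof.
move=> p0 Sp; rewrite /= (path_sortedE ltn_trans) Sp andbT.
by apply/allP => x xp; rewrite /= lt0n; apply: contraNneq p0 => <-.
Qed.

Lemma layer_ft i A :
  let c := (left_column A, right_column A) in
  if pair_phi i c && (matM_eps i (bumped A) == 0%N) then
    exists A1, [/\ M_ft i A = Some A1,
      (left_column A1, right_column A1) = pair_ft i c & bumped A1 = bumped A]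
  else forall D, M_ft i (bumped A) = Some D ->
    exists A1, [/\ M_ft i A = Some A1,
      (left_column A1, right_column A1) = c & bumped A1 = D].
Proof.
case: i => [[|k]|k].
- have [Hp Hq /scan_corner [_]] := columns_scan A.
  move: (left_column A) (right_column A) (matM_eps 0 _) Hp Hq => p q e Hp Hq /=.
  case: andP => [[/andP [p0 q0] _] H|_ H].
    exists (A `+` [mset (0, 0)%N])%mset.
    by have [||-> -> ->] := scan_columns _ _ H; try exact: sorted_cons0.
  move=> D [<-]; exists (A `+` [mset (0, 0)%N])%mset.
  by have [//|//|-> -> ->] := scan_columns _ _ H.
- exact: layer_ft_pos.
- have := layer_ft_pos k (tr_mset A); rewrite !M_ft_neg.
  have [-> -> ->] := columns_tr A; rewrite /=.
  case: ifP => _.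
    case=> A1 [-> [E1 E2] E3]; exists (tr_mset A1).
    by have [-> -> ->] := columns_tr A1; rewrite E1 E2 E3 tr_msetK.
  move=> H D; case ED: (M_ft _ (tr_mset (bumped A))) => [D'|] //= [<-].
  have [A1 [-> [E1 E2] E3]] := H _ ED; exists (tr_mset A1).
  by have [-> -> ->] := columns_tr A1; rewrite E1 E2 E3.
Qed.

(** * Semi-infinite words *)

Lemma weight_eqP (x y : weight) :
  (forall k, coeff k x.1 = coeff k y.1) -> x.2 = y.2 -> x = y.
Proof.
by case: x y => [x a] [y b] /= H ->; congr (_, _); apply/eqP/freeg_eqP.
Qed.

Lemma coeff_mulz k (x : weight) (n : int) : coeff k (x *~ n).1 = coeff k x.1 *~
  n.
Proof.
have H m : coeff k (x *+ m).1 = coeff k x.1 *+ m.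
  by elim: m => [|m IHm]; rewrite ?mulr0n ?coeff0 // !mulrS coeffD IHm.
by case: n => m; rewrite ?NegzE -?pmulrn ?mulrNz -?pmulrn ?coeffN H.
Qed.

Lemma coeff_sum_epsilon (s : seq zstar) (f : zstar -> int) k : uniq s ->
  coeff k (\sum_(j <- s) epsilon j *~ f j).1 = if k \in s then f k else 0.
Proof.
elim: s => [|j s IHs] /=; first by rewrite big_nil coeff0.
case/andP=> js Us; rewrite big_cons coeffD IHs // coeff_mulz coeff_epsilon inE.
rewrite [k == j]eq_sym; case: (eqVneq j k) => [<-|_] /=.
  by rewrite (negPf js) addr0 intz.
by rewrite mul0rz add0r.
Qed.

Lemma sum_epsilon_snd (s : seq zstar) (f : zstar -> int) :
  (\sum_(j <- s) epsilon j *~ f j).2 = 0.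
Proof.
elim: s => [|j s IHs]; first by rewrite big_nil.
have H m : (epsilon j *+ m).2 = 0 by elim: m => [|m IHm] //;
  rewrite mulrS /= IHm.
rewrite big_cons /= IHs addr0.
by case: (f j) => m; rewrite ?NegzE -?pmulrn ?mulrNz -?pmulrn /= H ?oppr0.
Qed.

Lemma siword_decr (w : siword) m m' : (m < m')%N ->
  val (val w m') < val (val w m).
Proof.
have /asboolP [H _] := valP w.
elim: m' => // m' IHm; rewrite ltnS leq_eqVlt => /orP [/eqP ->|/IHm];
  first exact: H.
exact: lt_trans (H m').
Qed.

Lemma siword_inj (w : siword) : injective (val w).
Proof.
by move=> m m' E; case: (ltngtP m m') => // /(siword_decr w); rewrite E ltxx.
Qed.

Lemma occursP k (w : siword) : reflect (exists m, val w m = k) (occurs k w).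
Proof. exact: asboolP. Qed.

(** If the earlier letters of u and u' agree, the m-th letter of u' occurs in u at an index at least
    m, hence is at most the m-th letter of u; the roles are symmetric. *)
Lemma siword_ext (w w' : siword) : (forall k, occurs k w = occurs k w') ->
  w = w'.
Proof.
move=> H; apply: val_inj; apply/funext => m.
elim/ltn_ind: m => m IHm.
have aux (u u' : siword) : (forall k, occurs k u = occurs k u') ->
    (forall m', (m' < m)%N -> val u m' = val u' m') ->
      val (val u' m) <= val (val u m).
  move=> Huu IHu; rewrite leNgt; apply/negP => lt_um.
  have /occursP [m' Em'] : occurs (val u' m) u by rewrite Huu; apply/occursP;
    exists m.
  case: (ltnP m' m) => mm'.
    have := IHu m' mm'; rewrite Em' => /siword_inj E.
    by rewrite E ltnn in mm'.
  have : val (val u m') <= val (val u m).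
    by move: mm'; rewrite leq_eqVlt => /orP [/eqP ->//|/(siword_decr u)/ltW].
  by rewrite Em' leNgt lt_um.
apply: val_inj; apply/eqP; rewrite eq_le !aux // => m' /IHm //.
Qed.

Lemma siword_support (w : siword) : exists B : nat,
  forall m, (B <= m)%N -> occurs (zneg m) w /\ ~~ occurs (zpos m) w.
Proof.
have /asboolP [_ [c [N HN]]] := valP w.
exists (N + absz c + absz (val (val w 0%N)))%N => m Hm; split.
  (* The stable part has the letter -(m' + 1) + c at index m', which is -(m + 1) for m' = m + c. *)
  apply/occursP; exists (absz (m%:Z + c)); apply: val_inj => /=.
  have Ec : (absz (m%:Z + c))%:Z = m%:Z + c by lia.
  by rewrite HN; lia.
apply/occursP => -[m' Em'].
have : val (val w m') <= val (val w 0%N).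
  by case: m' {Em'} => // m'; apply/ltW/siword_decr.
rewrite Em'; move: Hm; move: (val (val w 0%N)) => x Hm; rewrite [val _]/=; lia.
Qed.

Lemma zstarP (k : zstar) : (exists m, k = zpos m) \/ exists m, k = zneg m.
Proof.
case: k => -[[|m]|m] Hk; [by []|left|right]; exists m; exact: val_inj.
Qed.

Lemma Fcal_wt_coeff (w : siword) k : coeff k (wt (p := Fcal) w).1 = mult w k.
Proof.
have [B HB] := siword_support w.
pose s := [seq zneg m | m <- iota 0 B] ++ [seq zpos m | m <- iota 0 B].
have s0 j : j \notin undup s -> mult w j = 0.
  rewrite mem_undup mem_cat negb_or => /andP [jn jp].
  case: (zstarP j) => -[m Em].
    have [|_] := HB m; last by rewrite /mult Em => /negPf ->.
    rewrite leqNgt; apply/negP => mB; move/negP: jp; apply.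
    by apply/mapP; exists m => //; rewrite mem_iota.
  have [|H _] := HB m; last by rewrite /mult Em H.
  rewrite leqNgt; apply/negP => mB; move/negP: jn; apply.
  by apply/mapP; exists m => //; rewrite mem_iota.
rewrite /= (@fsbigE _ _ _ _ _ (undup s)) ?undup_uniq //; last first.
  by move=> j _ /s0 ->; rewrite mulr0z.
rewrite (eq_bigl xpredT); last by move=> j; rewrite in_setT.
rewrite coeffD coeff0 add0r coeff_sum_epsilon ?undup_uniq //.
by case: ifP => // /negbT /s0 ->.
Qed.

Lemma Fcal_wt_snd (w : siword) : (wt (p := Fcal) w).2 = 1.
Proof.
by rewrite /= sum_epsilon_snd addr0.
Qed.

Lemma occurs_replace (a b : zstar) (w w' : siword) :
  occurs a w -> val w' = replace_letter a b w ->
  forall k, occurs k w' = (k == b) || (k != a) && occurs k w.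
Proof.
move=> /occursP [m0 Em0] Ew k;
  apply/occursP/idP => [[m]|/orP [/eqP ->|/andP [ka]]].
- rewrite Ew /replace_letter; case: eqP => [_ <-|wa <-]; first by rewrite eqxx.
  by apply/orP; right; apply/andP; split; [apply/eqP | apply/occursP; exists m].
- by exists m0; rewrite Ew /replace_letter Em0 eqxx.
- move/occursP => [m Em]; exists m; rewrite Ew /replace_letter Em.
  by rewrite (negPf ka).
Qed.

(** No other letter lies between a and b, so replacing one by the other keeps a word strictly
    decreasing. As 0 is not a letter, -1 and 1 qualify. *)
Definition adjacent (a b : zstar) := forall k : zstar, k != a -> k != b ->
  (val k < val a) = (val k < val b).

Lemma adjacent_sym a b : adjacent a b -> adjacent b a.
Proof. by move=> H k kb ka; rewrite H. Qed.

Lemma adjacent_lpq i : adjacent (lp i) (lq i).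
Proof.
case=> j Hj; rewrite -!val_eqE /=; move: Hj.
by case: i => [[|i]|i] /=; lia.
Qed.

Lemma replace_has_charge (a b : zstar) (w : siword) c : occurs a w ->
  has_charge c (val w) -> has_charge c (replace_letter a b w).
Proof.
move=> /occursP [m0 Em0] [N HN]; exists (N + m0.+1)%N => m Hm.
rewrite /replace_letter ifF; first by apply: HN; lia.
apply/negbTE; rewrite -Em0; apply/eqP => /siword_inj E; lia.
Qed.

Lemma to_siword_replace (a b : zstar) (w : siword) :
  occurs a w -> ~~ occurs b w -> adjacent a b ->
  exists w', to_siword (replace_letter a b w) = Some w' /\
    val w' = replace_letter a b w.
Proof.
move=> aw bw adj; have /asboolP [_ [c Hc]] := valP w.
have Hs : is_siword (replace_letter a b w).
  apply/asboolP; split; last by exists c; apply: replace_has_charge.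
  move=> m; have wb m' : val w m' != b.
    by apply: contraNneq bw => Eb; apply/occursP; exists m'.
  have := siword_decr w (ltnSn m); rewrite /replace_letter.
  case: (eqVneq (val w m.+1) a) => [Ea|na];
    case: (eqVneq (val w m) a) => [Ea'|na'] //.
  - by rewrite Ea Ea' ltxx.
  - rewrite Ea => lt_a; have := adj _ na' (wb m); rewrite ltNge (ltW lt_a) /=.
    move/esym/negbT; rewrite -leNgt le_eqVlt => /orP [/eqP/val_inj E|//].
    by have := wb m; rewrite E eqxx.
  - by rewrite Ea' adj.
by exists (Sub _ Hs); rewrite /to_siword insubT.
Qed.

Lemma Fcal_ft_someE i (w w' : siword) : ft (p := Fcal) i w = Some w' ->
  [/\ occurs (lp i) w, ~~ occurs (lq i) w &
  val w' = replace_letter (lp i) (lq i) w].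
Proof.
rewrite /=; case: ifP => // /andP [H1 H2]; rewrite /to_siword.
by case: insubP => // u _ Eu [<-].
Qed.

Lemma Fcal_et_someE i (w w' : siword) : et (p := Fcal) i w = Some w' ->
  [/\ occurs (lq i) w, ~~ occurs (lp i) w &
  val w' = replace_letter (lq i) (lp i) w].
Proof.
rewrite /=; case: ifP => // /andP [H1 H2]; rewrite /to_siword.
by case: insubP => // u _ Eu [<-].
Qed.

Lemma replace_letterK (a b : zstar) (w w' : siword) : ~~ occurs b w ->
  val w' = replace_letter a b w -> replace_letter b a w' = val w.
Proof.
move=> bw Ew; apply/funext => m; rewrite /replace_letter Ew /replace_letter.
case: (eqVneq (val w m) a) => [->|_]; first by rewrite eqxx.
by case: eqP => // Eb; case/negP: bw; apply/occursP; exists m.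
Qed.

Lemma Fcal_crystal : is_crystal Fcal.
Proof.
have lpq i : (lp i == lq i) = false := lp_neq_lq i.
have lqp i : (lq i == lp i) = false by rewrite eq_sym lpq.
have wt_replace a b (w w' : siword) : occurs a w -> ~~ occurs b w -> a != b ->
    val w' = replace_letter a b w ->
    wt (p := Fcal) w' = wt (p := Fcal) w + (epsilon b - epsilon a).
  move=> aw bw ab Ew; apply: weight_eqP => [k|].
    have E (x y z : weight) : coeff k (x + (y - z)).1
      = coeff k x.1 + (coeff k y.1 - coeff k z.1) by rewrite !coeffD coeffN.
    rewrite E !Fcal_wt_coeff !coeff_epsilon /mult.
    rewrite (occurs_replace aw Ew) ![_ == k]eq_sym.
    case: (eqVneq k a) => [->|ka]; first by rewrite aw (negPf ab) /b2z; lia.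
    case: (eqVneq k b) => [->|kb]; first by rewrite (negPf bw) /b2z; lia.
    by rewrite /b2z; lia.
  have E (x y z : weight) : (x + (y - z)).2 = x.2 + (y.2 - z.2) by [].
  by rewrite E !Fcal_wt_snd.
have ftet i (w w' : Fcal) : ft i w = Some w' -> et i w' = Some w.
  move=> /Fcal_ft_someE [H1 H2 Ew] /=;
    rewrite !(occurs_replace H1 Ew) !eqxx lpq /=.
  by rewrite (replace_letterK H2 Ew) /to_siword valK.
have etft i (w w' : Fcal) : et i w = Some w' -> ft i w' = Some w.
  move=> /Fcal_et_someE [H1 H2 Ew] /=;
    rewrite !(occurs_replace H1 Ew) !eqxx lqp /=.
  by rewrite (replace_letterK H2 Ew) /to_siword valK.
have Hft i (b b' : Fcal) : ft i b = Some b' ->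
    [/\ eps i b' = zadd (eps i b) 1, phi i b' = zadd (phi i b) (- 1)
      & wt b' = wt b - alpha i].
  move=> /Fcal_ft_someE [H1 H2 Ew]; split.
  - by rewrite /= !(occurs_replace H1 Ew) !eqxx lpq H1 (negPf H2).
  - by rewrite /= !(occurs_replace H1 Ew) !eqxx lpq H1 (negPf H2).
  - by rewrite (wt_replace _ _ _ _ H1 H2 _ Ew) ?lpq // /alpha opprB.
split=> //.
- move=> i w; rewrite /pairing !Fcal_wt_coeff Fcal_wt_snd /mult.
  rewrite [phi _ _]/= [eps _ _]/=.
  (* Subtracting the vacuum in [mult] costs 1 at i = 0 only, where Lambda_0 contributes 1. *)
  have <- : b2z (val (lp i) < 0) - b2z (val (lq i) < 0) = if i == 0 then 1 else
    0.
    by case: i => [[|i]|i].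
  by congr Some; rewrite /b2z; case: (occurs _ _) (occurs _ _) => [] []; lia.
- move=> i b b' /etft /Hft [-> -> ->]; split; last by rewrite subrK.
    by case: (eps i b') => //= x; congr Some; lia.
  by case: (phi i b') => //= x; congr Some; lia.
- by move=> i b b'; split; [apply: ftet | apply: etft].
Qed.

(** * The two columns of a semi-infinite word *)

Definition siword_columns (w : siword) : seq nat * seq nat :=
  (column [set m | ~~ occurs (zneg m) w]%classic,
   column [set m | occurs (zpos m) w]%classic).

Lemma column_sorted A : sorted ltn (column A).
Proof.
by rewrite ltn_sorted_uniq_leq sort_uniq fset_uniq sort_sorted //;
  apply: leq_total.
Qed.

Lemma mem_column (A : set nat) : finite_set A ->
  forall m, (m \in column A) = (m \in A).
Proof. by move=> fA m; rewrite mem_sort in_fset_set. Qed.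

Lemma finite_below (A : set nat) (B : nat) :
  (forall m, A m -> (m < B)%N) -> finite_set A.
Proof.
move=> H; apply: (@sub_finite_set _ _ [set` iota 0 B]%classic);
  last exact: finite_seq.
by move=> m /H /=; rewrite mem_iota.
Qed.

Lemma mem_siword_columns (w : siword) m :
  (m \in (siword_columns w).1) = ~~ occurs (zneg m) w /\
  (m \in (siword_columns w).2) = occurs (zpos m) w.
Proof.
have [B HB] := siword_support w.
split; rewrite mem_column; try by apply/idP/idP => [/set_mem|] // H;
  apply/mem_set.
  apply: (@finite_below _ B) => k /= Hk; rewrite ltnNge; apply/negP => /HB [].
  by rewrite (negPf Hk).
apply: (@finite_below _ B) => k /= Hk; rewrite ltnNge; apply/negP => /HB [_].
by rewrite Hk.
Qed.

Lemma siword_columns_inj : injective siword_columns.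
Proof.
move=> w w' E; apply: siword_ext => k; case: (zstarP k) => -[m ->].
  by have [_ <-] := mem_siword_columns w m;
    have [_ <-] := mem_siword_columns w' m; rewrite E.
apply: negb_inj.
by have [<- _] := mem_siword_columns w m;
  have [<- _] := mem_siword_columns w' m; rewrite E.
Qed.

Lemma lp_pos (k : nat) : lp k.+1 = zpos k.
Proof. exact: val_inj. Qed.
Lemma lq_pos (k : nat) : lq k = zpos k.
Proof. by apply: val_inj; rewrite /=; lia. Qed.
Lemma lp_neg (k : nat) : lp (Negz k) = zneg k.+1.
Proof. by apply: val_inj; rewrite /=; lia. Qed.
Lemma lq_neg (k : nat) : lq (Negz k) = zneg k.
Proof. by apply: val_inj; rewrite /=; lia. Qed.
Lemma lp_0 : lp 0 = zneg 0.
Proof. exact: val_inj. Qed.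

Lemma Fcal_phiE i (w : siword) :
  phi (p := Fcal) i w = Some (b2z (pair_phi i (siword_columns w))).
Proof.
have H m := mem_siword_columns w m.
rewrite /=; congr (Some (b2z _)); case: i => [[|k]|k].
- by rewrite lp_0 lq_pos /pair_phi (H 0%N).1 (H 0%N).2 negbK.
- by rewrite lp_pos lq_pos /pair_phi (H k).2 (H k.+1).2.
- by rewrite lp_neg lq_neg /pair_phi (H k).1 (H k.+1).1 negbK andbC.
Qed.

Lemma Fcal_epsE i (w : siword) (e : nat) :
  zmax (eps (p := Fcal) i w)
    (zadd (Some e%:Z) (- pairing (wt (p := Fcal) w) i))
  = Some (pair_eps i (siword_columns w) e)%:Z.
Proof.
have H m := mem_siword_columns w m.
have -> : pair_eps i (siword_columns w) e =
    if occurs (lp i) w then if occurs (lq i) w then e else e.-1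
    else if occurs (lq i) w then e.+1 else e.
  case: i => [[|k]|k].
  - by rewrite lp_0 lq_pos /pair_eps (H 0%N).1 (H 0%N).2; case: occurs;
    case: occurs.
  - by rewrite lp_pos lq_pos /pair_eps /column_eps (H k).2 (H k.+1).2.
  - by rewrite lp_neg lq_neg /pair_eps /column_eps (H k).1 (H k.+1).1;
      case: occurs; case: occurs.
have Ep : b2z (occurs (lp i) w && ~~ occurs (lq i) w) =
    b2z (occurs (lq i) w && ~~ occurs (lp i) w) + pairing (wt (p := Fcal) w) i.
  by have [] := @crystal_phi _ Fcal_crystal i w.
rewrite [eps (p := Fcal) i w]/=; move: Ep.
set x := occurs (lp i) w; set y := occurs (lq i) w => Ep.
have {Ep}-> : pairing (wt (p := Fcal) w) i = b2z (x && ~~ y) - b2z (y && ~~ x).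
  by rewrite Ep addrAC subrr add0r.
rewrite /zmax /= /b2z {H}; case: x; case: y => /=.
all: try (case Hn: (_ <= _)%R); congr Some; lia.
Qed.

Lemma column_ft_sorted c q : sorted ltn q -> c \in q -> c.+1 \notin q ->
  sorted ltn (column_ft c q).
Proof.
move=> Sq cq c1q; apply: sorted_column_bump => // y yq.
by rewrite leq_eqVlt => /orP [/eqP Ey|//]; rewrite -Ey yq in c1q.
Qed.

Lemma mem_columns_eq (p q : seq nat) : sorted ltn p -> sorted ltn q ->
  p =i q -> p = q.
Proof. exact: irr_sorted_eq ltn_trans ltnn _ _. Qed.

(** Negative letters are recorded by their absence: for i < 0, moving [lp i] to [lq i] moves the gap
    the other way, and for i = 0 a gap at -1 and the letter 1 appear together. *)
Lemma siword_columns_ft i (w w' : siword) : ft (p := Fcal) i w = Some w' ->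
  siword_columns w' = pair_ft i (siword_columns w).
Proof.
move=> /Fcal_ft_someE [H1 H2 Ew]; have Eo := occurs_replace H1 Ew.
have S1 u : sorted ltn (siword_columns u).1 by apply: column_sorted.
have S2 u : sorted ltn (siword_columns u).2 by apply: column_sorted.
have M1 u m := (mem_siword_columns u m).1.
have M2 u m := (mem_siword_columns u m).2.
rewrite [LHS]surjective_pairing; move: H1 H2 Eo {Ew}.
case: i => [[|k]|k] => [|//|]; rewrite /pair_ft.
- rewrite lp_0 lq_pos => H1 H2 Eo.
  congr (_, _); apply: mem_columns_eq => //.
  + by apply: sorted_cons0; rewrite // M1 negbK.
  + by move=> m; rewrite inE !M1 Eo; case: m => [|m]; rewrite ?H1.
  + by apply: sorted_cons0; rewrite // M2.
  + by move=> m; rewrite inE !M2 Eo; case: m => [|m].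
- rewrite lp_pos lq_pos => H1 H2 Eo.
  congr (_, _); apply: mem_columns_eq => //.
  + by move=> m; rewrite !M1 Eo.
  + by apply: column_ft_sorted; rewrite ?M2.
  + move=> m; rewrite mem_column_ft ?M2 // Eo.
    by rewrite andbC.
- rewrite lp_neg lq_neg => H1 H2 Eo.
  congr (_, _); apply: mem_columns_eq => //.
  + by apply: column_ft_sorted; rewrite ?M1 ?negbK.
  + move=> m; rewrite mem_column_ft ?M1 // Eo.
    rewrite -!val_eqE /= !eqr_opp !eqz_nat !eqSS negb_or negb_and negbK.
    case: (eqVneq m k) => [->|mk] /=; last by rewrite andbT.
    by rewrite andbF orbF (ltn_eqF (ltnSn k)).
  + by move=> m; rewrite !M2 Eo.
Qed.

(** * Semi-infinite tableaux and matrices *)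

Lemma word_eps_cons (B : precrystal) i (b : B) (s : seq B) : word_eps i (b :: s)
  =
  zmax (eps i b) (zadd (word_eps i s) (- pairing (wt b) i)).
Proof. by []. Qed.

Lemma zle_zmax (a x c : zbar) : zle (zmax a x) c -> zle a c.
Proof.
rewrite /zmax; case: ifP => //; case: a x c => [a|] [x|] [c|] //= ax xc.
exact: le_trans ax xc.
Qed.

Lemma word_ft_cons (B : precrystal) i (b : B) (s : seq B) : word_ft i (b :: s) =
  if ~~ zle (phi i b) (word_eps i s) then omap (cons^~ s) (ft i b)
  else omap (cons b) (word_ft i s).
Proof. by []. Qed.

Lemma word_et_cons (B : precrystal) i (b : B) (s : seq B) : word_et i (b :: s) =
  if zle (word_eps i s) (phi i b) then omap (cons^~ s) (et i b)
  else omap (cons b) (word_et i s).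
Proof. by []. Qed.

Lemma matM_eps0 i : matM_eps i mset0 = 0%N.
Proof.
have tr0 : tr_mset mset0 = mset0 by apply/eqP; rewrite tr_mset_eq0.
by case: i => [[|k]|k]; rewrite /matM_eps ?mset0E ?tr0 ?biword_kl0.
Qed.

Lemma layered_eps i A (ws : seq siword) :
  layered A [seq siword_columns w | w <- ws] ->
  word_eps (B := Fcal) i ws = Some (matM_eps i A)%:Z.
Proof.
elim: ws A => [|w ws IHws] A /=; first by move=> ->; rewrite matM_eps0.
case=> Ep Eq /IHws ->; by rewrite Fcal_epsE (layer_eps i A) Ep Eq.
Qed.

(** The word rule and [layer_ft] decide by the same test whether f_i acts on the first column or on
    the rest, since [layered_eps] identifies eps of the rest. *)
Lemma layered_ft i A (ws ws' : seq siword) :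
  layered A [seq siword_columns w | w <- ws] ->
  word_ft (B := Fcal) i ws = Some ws' ->
  exists2 A', M_ft i A = Some A' & layered A' [seq siword_columns w | w <- ws'].
Proof.
elim: ws A ws' => [//|w ws IHws] A ws' [Ep Eq HA].
have := layer_ft i A; rewrite Ep Eq -/(siword_columns w) [LHS in LHS -> _]/=.
rewrite (word_ft_cons (B := Fcal)) (layered_eps i HA) Fcal_phiE.
have -> (b : bool) (e : nat) : ~~ zle (Some (b2z b)) (Some e%:Z) = b && (e ==
  0%N).
  by case: b e => [] [|e].
case: ifP => _ H.
  case Ew: (ft (p := Fcal) i w) => [w'|] //= [<-]; have [A1 [-> E12 E3]] := H.
  by exists A1 => //; split; rewrite ?(siword_columns_ft Ew) -?E12 ?E3.
case Ews: (word_ft (B := Fcal) i ws) => [ws1|] //= [<-].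
have [D ED HD] := IHws _ _ HA Ews; have [A1 [-> E12 E3]] := H _ ED.
by exists A1 => //; split; rewrite -?E12 ?E3.
Qed.

(* The measure for the descent to the vacuum along the raising operators. *)
Definition degree (ws : seq siword) : nat :=
  \sum_(w <- ws) (\sum_(x <- (siword_columns w).1) x.+1
    + \sum_(x <- (siword_columns w).2) x.+1).

Lemma column_ft_degree k q : k \in q ->
  (\sum_(x <- q) x.+1 < \sum_(x <- column_ft k q) x.+1)%N.
Proof.
move=> kq; rewrite big_map (big_rem k) //= [ltnRHS](big_rem k) //= eqxx.
rewrite -addSn leq_add // leq_sum // => x _.
by case: eqP => // ->; apply: leqnSn.
Qed.

Lemma word_ft_degree i (ws ws' : seq siword) :
  word_ft (B := Fcal) i ws = Some ws' -> (degree ws < degree ws')%N.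
Proof.
elim: ws ws' => // w ws IHws ws'.
rewrite (word_ft_cons (B := Fcal)); case: ifP => _; last first.
  case Ews: (word_ft (B := Fcal) i ws) => [ws1|] //= [<-].
  by rewrite /degree !big_cons ltn_add2l; apply: IHws.
case Ew: (ft (p := Fcal) i w) => [w'|] //= [<-].
rewrite /degree !big_cons ltn_add2r (siword_columns_ft Ew).
have : pair_phi i (siword_columns w).
  have := Fcal_phiE i w; have [H1 H2 _] := Fcal_ft_someE Ew.
  by rewrite /= H1 H2; case: pair_phi.
case: (siword_columns w) => p q {IHws Ew}.
case: i => [[|k]|k] /=.
- by rewrite !big_cons => _; lia.
- by move=> /andP [/column_ft_degree kq _]; rewrite ltn_add2l.
- by move=> /andP [/column_ft_degree kp _]; rewrite ltn_add2r.
Qed.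

(** * Raising operators preserve the inequalities between columns *)

Definition siword_ge (u v : siword) : bool :=
  `[< forall m, val (val v m) <= val (val u m) >].

Lemma siword_ge_trans : transitive siword_ge.
Proof.
move=> v u w /asboolP uv /asboolP vw; apply/asboolP => m.
exact: le_trans (vw m) (uv m).
Qed.

Lemma lp_lt_lq i : val (lp i) < val (lq i).
Proof. by case: i => [[|k]|k] /=; lia. Qed.

Lemma et_siword_ge i (w w' : siword) : et (p :=
  Fcal) i w = Some w' -> siword_ge w w'.
Proof.
move=> /Fcal_et_someE [_ _ Ew]; apply/asboolP => m; rewrite Ew /replace_letter.
by case: eqP => [->|//]; apply/ltW/lp_lt_lq.
Qed.

Lemma word_et_head i (w : siword) (ws ws' : seq siword) :
  word_et (B := Fcal) i (w :: ws) = Some ws' ->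
  exists v vs, ws' = v :: vs /\ siword_ge w v.
Proof.
rewrite (word_et_cons (B := Fcal)); case: ifP => _.
  case Ew: (et (p := Fcal) i w) => [w'|] //= [<-].
  by exists w', ws; split=> //; apply: et_siword_ge Ew.
case: (word_et (B := Fcal) i ws) => //= vs [<-]; exists w, vs; split=> //.
by apply/asboolP.
Qed.

(** Lowering w can only hurt where w and the next column v share the letter [lq i]. As e_i acts on
    w, eps_i(v) = 0, so v also contains [lp i], further on; this squeezes the next letter of w
    strictly between [lp i] and [lq i]. *)
Lemma word_et_sorted i (ws ws' : seq siword) : sorted siword_ge ws ->
  word_et (B := Fcal) i ws = Some ws' -> sorted siword_ge ws'.
Proof.
elim: ws ws' => // w ws IHws ws' Hws.
rewrite (word_et_cons (B := Fcal)); case: ifP => Hle; last first.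
  case Ews: (word_et (B := Fcal) i ws) => [ws1|] //= [<-].
  have := IHws _ (path_sorted Hws) Ews.
  case: ws Hws Ews {IHws Hle} =>
    [//|v vs /andP [wv _]] /word_et_head [v' [vs' [-> vv']]].
  by move=> /= ->; rewrite (siword_ge_trans wv vv').
case Ew: (et (p := Fcal) i w) => [w'|] //= [<-].
case: ws Hws Hle {IHws} => [//|v vs] Hws Hle;
  move: Hws => /= /andP [/asboolP wv ->].
rewrite andbT.
have [oq op Ew'] := Fcal_et_someE Ew; apply/asboolP => m.
rewrite Ew' /replace_letter; case: eqP => [wm|_]; last exact: wv.
have := wv m; rewrite wm le_eqVlt => /orP [/eqP/val_inj vm|]; last first.
  case: (eqVneq (val v m) (lp i)) => [->//|np] lt_q.
  apply: ltW; rewrite (adjacent_lpq np) //.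
  by apply/eqP => E; rewrite E ltxx in lt_q.
have oqv : occurs (lq i) v by apply/occursP; exists m.
have /occursP [m' Em'] : occurs (lp i) v.
  apply: contraLR Hle => npv; apply/negP => /zle_zmax.
  by rewrite /= oqv npv (negPf op).
have mm' : (m < m')%N.
  rewrite ltnNge leq_eqVlt; apply/negP => /orP [/eqP E|/(siword_decr v)].
    by move: Em'; rewrite E vm => /eqP; rewrite eq_sym lp_neq_lq.
  by rewrite Em' vm ltNge (ltW (lp_lt_lq i)).
have le_p : val (lp i) <= val (val w m.+1).
  apply: le_trans (wv _); rewrite -Em'.
  by move: mm'; rewrite leq_eqVlt => /orP [/eqP ->//|/(siword_decr v)/ltW].
have no k : val w k != lp i by apply: contraNneq op => E; apply/occursP;
  exists k.
have lt_q := siword_decr w (ltnSn m); rewrite wm in lt_q.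
have nq : val w m.+1 != lq i by apply/eqP => E; rewrite E ltxx in lt_q.
by move: le_p; rewrite leNgt (adjacent_lpq (no _) nq) lt_q.
Qed.

Lemma in_BnLambda0_et n i (ws ws' : seq siword) : in_BnLambda0 n ws ->
  word_et (B := Fcal) i ws = Some ws' -> in_BnLambda0 n ws'.
Proof.
case/and3P => Hn Hc Hs E; apply/and3P; split; last exact: word_et_sorted Hs E.
- rewrite -(eqP Hn); apply/eqP; elim: ws ws' E {Hn Hc Hs} => // w ws IHws ws'.
  rewrite (word_et_cons (B := Fcal)); case: ifP => _.
    by case: (et (p := Fcal) i w) => //= w' [<-].
  by case E: (word_et (B := Fcal) i ws) => [ws1|] //= [<-] /=;
    rewrite (IHws _ E).
- elim: ws ws' E Hc {Hn Hs} => // w ws IHws ws'.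
  rewrite (word_et_cons (B := Fcal)); case: ifP => _.
    case Ew: (et (p := Fcal) i w) => [w'|] //= [<-] /andP [/asboolP cw].
    move=> /= ->; rewrite andbT; apply/asboolP.
    have [oq _ ->] := Fcal_et_someE Ew; exact: replace_has_charge.
  by case E: (word_et (B :=
    Fcal) i ws) => [ws1|] //= [<-] /= /andP [-> /(IHws _ E)].
Qed.

(** If e_i is directed to w, then eps of the tail is at most phi_i(w); with eps_i(w) = 0 this would
    make eps of the whole word 0. *)
Lemma word_et_some i (ws : seq siword) :
  zle (word_eps (B := Fcal) i ws) (Some 0) = false ->
  exists ws', word_et (B := Fcal) i ws = Some ws'.
Proof.
elim: ws => [//|w ws IHws]; rewrite (word_et_cons (B := Fcal)).
have Ephi := @crystal_phi _ Fcal_crystal i w.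
have := word_eps_fin (B := Fcal) i ws; rewrite (word_eps_cons (B := Fcal)).
move: (pairing _ i) Ephi => x Ephi.
case Ee: (word_eps (B := Fcal) i ws) IHws => [e|] // IHws _ Hpos.
case: ifP => Hle; last first.
  have [|ws' ->] := IHws; last by exists (w :: ws').
  move: Hle; rewrite [phi (p := Fcal) i w]/= /b2z /=.
  by case: (occurs _ _ && _) => /=; case: (e) => [[|?]|?].
have [oq op] : occurs (lq i) w /\ ~~ occurs (lp i) w.
  apply/andP; apply: contraFT Hpos => Hn; move: Ephi Hle.
  rewrite [eps (p := Fcal) i w]/= (negPf Hn) /b2z [zadd _ _]/= add0r.
  case: (phi (p := Fcal) i w) => [f|] //= [->]; rewrite /zmax /=.
  by case: ifP => //=; rewrite subr_le0.
rewrite [et (p := Fcal) i w]/= oq op /=.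
have [w' [-> _]] := to_siword_replace oq op (adjacent_sym (@adjacent_lpq i)).
by exists (w' :: ws).
Qed.

(** * Descent to the vacuum *)

Definition vacuum (w : siword) : Prop := forall m, val (val w m) = - m.+1%:Z.

Lemma occurs_vacuum w : vacuum w -> forall k, occurs k w = (val k < 0).
Proof.
move=> Hw k; case: (zstarP k) => -[m ->].
  transitivity false => //; apply/negbTE/occursP => -[m' E].
  by have := Hw m'; rewrite E.
transitivity true => //; apply/occursP; exists m; apply: val_inj.
by rewrite Hw.
Qed.

Lemma siword_columns_vacuum w : vacuum w -> siword_columns w = ([::], [::]).
Proof.
move=> /occurs_vacuum Hw; rewrite [LHS]surjective_pairing.
by congr (_, _); apply: mem_columns_eq; rewrite ?column_sorted // => m;
  rewrite ?(mem_siword_columns w m).1 ?(mem_siword_columns w m).2 Hw.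
Qed.

Lemma wt_vacuum w : vacuum w -> wt (p := Fcal) w = Lambda0.
Proof.
move=> /occurs_vacuum Hw; apply: weight_eqP => [k|]; last exact: Fcal_wt_snd.
by rewrite Fcal_wt_coeff /mult Hw subrr coeff0.
Qed.

Lemma layered_vacuum (ws : seq siword) : all (fun w => `[< vacuum w >]) ws ->
  layered mset0 [seq siword_columns w | w <- ws] /\
  word_wt (B := Fcal) ws = Lambda0 *+ size ws.
Proof.
elim: ws => [|w ws IHws]; first by rewrite /word_wt big_nil.
move=> /andP [/asboolP Hw /IHws [H1 H2]]; split.
  by rewrite map_cons siword_columns_vacuum //=; have [-> -> ->] := columns0.
by rewrite /word_wt big_cons wt_vacuum // -/(word_wt (B := Fcal) ws) H2 mulrS.
Qed.

(** A strictly decreasing word that ends in the vacuum gains at least one at each step backwards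
    from its stable part. *)
Lemma charge0_ge (w : siword) m : has_charge 0 (val w) ->
  - m.+1%:Z <= val (val w m).
Proof.
move=> [N HN]; move: {2}(N - m)%N (leqnn (N - m)) => n.
elim: n m => [|n IHn] m Hm; first by rewrite HN ?addr0 // -subn_eq0 -leqn0.
case: (leqP N m) => [Nm|mN]; first by rewrite HN ?addr0.
have := IHn m.+1; have := siword_decr w (ltnSn m).
by move: (val (val w m)) (val (val w m.+1)) => x y; lia.
Qed.

Lemma word_et_not_vacuum (w : siword) (ws : seq siword) :
  has_charge 0 (val w) -> ~ vacuum w ->
  exists i ws', word_et (B := Fcal) i (w :: ws) = Some ws'.
Proof.
move=> Hc nv; have Hge m := charge0_ge m Hc; have [N0 HN0] := Hc.
pose P n := `[< forall m, (n <= m)%N -> val (val w m) = - m.+1%:Z >].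
have exP : exists n, P n by exists N0; apply/asboolP => m /HN0; rewrite addr0.
(* N is the last index at which w differs from the vacuum. Its letter can be lowered, as the
   predecessor exceeds all letters after it. *)
case: (ex_minnP exP) => -[|N] /asboolP HN minN.
  by case: nv => m; apply: HN.
have gtN : - N.+1%:Z < val (val w N).
  rewrite lt_neqAle Hge andbT; apply/eqP => E.
  have : P N by apply/asboolP => m; rewrite leq_eqVlt => /orP [/eqP <-|/HN].
  by move/minN; rewrite ltnn.
have [i Ei] : exists i, lq i = val w N.
  by case: (zstarP (val w N)) => -[m ->]; [exists m%:Z | exists (Negz m)];
    rewrite ?lq_pos ?lq_neg.
exists i; apply: word_et_some.
have oq : occurs (lq i) w by apply/occursP; exists N.
have op : ~~ occurs (lp i) w.
  apply/occursP => -[m Em]; have := lp_lt_lq i; rewrite Ei -Em => lt_m.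
  have Nm : (N < m)%N.
    rewrite ltnNge leq_eqVlt; apply/negP => /orP [/eqP E|/(siword_decr w)].
      by rewrite E ltxx in lt_m.
    by rewrite ltNge (ltW lt_m).
  have := HN m Nm; rewrite Em; move: gtN; rewrite -Ei.
  by case: (i) => [[|k]|k] /=; lia.
have := word_eps_fin (B := Fcal) i ws; rewrite (word_eps_cons (B := Fcal)).
rewrite [eps (p := Fcal) i w]/= oq op.
by move=> _; apply/negP => /zle_zmax.
Qed.

(** The first column dominates the others, and the vacuum is the least word of charge 0; hence the
    descent need only inspect the first column. *)
Lemma in_BnLambda0_vacuum n (w : siword) (ws : seq siword) :
  in_BnLambda0 n (w :: ws) -> vacuum w ->
    all (fun v => `[< vacuum v >]) (w :: ws).
Proof.
case/and3P=> _ /= /andP [_ Hc] Hs Hw; apply/andP; split; first exact/asboolP.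
have {Hs} : all (siword_ge w) ws := order_path_min siword_ge_trans Hs.
elim: ws Hc => //= v vs IHvs /andP [/asboolP cv Hc] /andP [/asboolP wv Hs].
rewrite IHvs // andbT; apply/asboolP => m; apply/eqP.
by rewrite eq_le (charge0_ge m cv) andbT -Hw wv.
Qed.

(** The weights are compared in the same induction: both sides are 0 at the vacuum and lose alpha_i
    under f_i. *)
Lemma layered_exists n (ws : seq siword) : in_BnLambda0 n ws ->
  exists A, layered A [seq siword_columns w | w <- ws] /\
    M_wt A = word_wt (B := Fcal) ws - Lambda0 *+ n.
Proof.
have wt0 : M_wt mset0 = 0.
  by rewrite M_wt_kl biword_kl0 /word_wt !big_nil addr0.
have vac us : in_BnLambda0 n us -> all (fun v => `[< vacuum v >]) us ->
    exists A, layered A [seq siword_columns w | w <- us] /\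
      M_wt A = word_wt (B := Fcal) us - Lambda0 *+ n.
  move=> /and3P [/eqP <- _ _] /layered_vacuum [H1 H2].
  by exists mset0; rewrite wt0 H2 subrr.
have [d] := ubnP (degree ws); elim: d ws => // d IHd ws.
rewrite ltnS => Hd Hws.
have [Hv|[i [ws1 E1]]] : all (fun v => `[< vacuum v >]) ws \/
    exists i ws1, word_et (B := Fcal) i ws = Some ws1.
- case: ws Hws {Hd} => [|w us] Hws; first by left.
  case: (pselect (vacuum w)) => Hw.
    by left; apply: in_BnLambda0_vacuum Hws Hw.
  right; apply: word_et_not_vacuum => //.
  by case/and3P: Hws => _ /= /andP [/asboolP].
- exact: vac.
have HF := words_crystal_at (proj1 (crystal_atP Fcal) Fcal_crystal i).
have E2 : word_ft (B := Fcal) i ws1 = Some ws by apply/(at_etft HF).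
have Hd1 := leq_trans (word_ft_degree E2) Hd.
have [A1 [HA1 wA1]] := IHd _ Hd1 (in_BnLambda0_et Hws E1).
have [A EA HA] := layered_ft HA1 E2; exists A; split=> //.
have [_ _ /= ->] := crystal_ft Mcal_crystal EA.
have [_ _ /= ->] := at_ft HF E2.
by rewrite wA1 addrAC.
Qed.

(** * The embedding *)

Lemma Psi_layered n (x : tensor (BnLambda0 n) (Tcrystal (- (Lambda0 *+ n)))) A :
  layered A [seq siword_columns w | w <- val x.1] -> Psi x = A.
Proof.
move=> /layered_kappa; rewrite /unzip1 /unzip2 -!map_comp => E.
by rewrite -[RHS]kappa_invK E.
Qed.

(* omap extends Psi_n by 0 |-> 0. *)
Theorem proposition4p3 (n : nat) (hn : (1 <= n)%N) :
  crystal_embedding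
    (B1 := tensor (BnLambda0 n) (Tcrystal (- (Lambda0 *+ n))%R))
    (B2 := Mcal)
    (omap (@Psi n)).
Proof.
set B1 := tensor _ _.
have words_crystal : is_crystal (words Fcal).
  apply/crystal_atP => i; apply: words_crystal_at.
  exact: (proj1 (crystal_atP Fcal) Fcal_crystal).
have B1_crystal : is_crystal B1 by apply/tensorT_crystal/subcrystal_crystal.
have Psi_spec (x : B1) :
    layered (Psi x) [seq siword_columns w | w <- val x.1] /\ M_wt (Psi x) = wt x.
  have [A [HA wA]] := layered_exists (valP x.1).
  by rewrite (Psi_layered HA); split.
have Psi_eps i (x : B1) : M_eps i (Psi x) = eps i x.
  have [/(layered_eps i) E _] := Psi_spec x; rewrite M_epsE -E.
  by rewrite [RHS]/= -/(word_eps (B := Fcal) i (val x.1)) E.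
have Psi_ft i (x y : B1) : ft i x = Some y -> M_ft i (Psi x) = Some (Psi y).
  have [HA _] := Psi_spec x => E.
  have {}E : word_ft (B := Fcal) i (val x.1) = Some (val y.1).
    move: E; case: x y {HA} => [ws []] [ws' []] /=; case: ifP => // _.
    by case: word_ft => [u|] //=; case: insubP => // u' _ <- [<-].
  by have [A' -> /Psi_layered <-] := layered_ft HA E.
split=> //; first exact: Mcal_crystal.
- split=> //.
  + by move=> x y [<-]; have [_] := Psi_spec x.
  + by move=> i x y [<-]; apply: Psi_eps.
  + move=> i x y [<-].
    rewrite (crystal_phi B1_crystal) (crystal_phi Mcal_crystal).
    by have [_ <-] := Psi_spec x; rewrite -Psi_eps.
  + move=> i x _; case E: (et i x) => [y|] //= _.
    apply/esym/(crystal_etft Mcal_crystal)/Psi_ft.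
    exact/(crystal_etft B1_crystal).
  + by move=> i x _; case E: (ft i x) => [y|] //= _; rewrite (Psi_ft _ _ _ E).
- apply: inj_omap => -[x []] [y []] /= E.
  have [Hx _] := Psi_spec (x, tt); have [Hy _] := Psi_spec (y, tt).
  congr (_, _); apply: val_inj; rewrite E in Hx.
  (* Both tuples have n columns, so peeling the common matrix compares them column by column,
     including the empty pairs that [kappa] does not show. *)
  have sz (u : BnLambda0 n) : size (val u) = n by case/and3P: (valP u) => /eqP.
  have : size (val x) = size (val y) by rewrite !sz.
  move: Hx Hy; move: (Psi _) (val x) (val y) => /=.
  move=> A u v; elim: u v A => [|w u IHu] [|w' v] A //= [Ep Eq /IHu H].
  case=> Ep' Eq' /H {}H [] /H ->; congr cons; apply: siword_columns_inj.
  rewrite [LHS]surjective_pairing; congr (_, _);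
    first exact: etrans (esym Ep) Ep'.
  exact: etrans (esym Eq) Eq'.
Qed.
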